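(* Let $E_1,\ldots,E_m$ be (real) Banach lattices. Suppose that $E_1^*,\ldots,E_m^*$ have the positive Schur property and that $A$ is a regular $m$-linear form on $E_1\times\cdots\times E_m$. Then $A^{*[m+1]}(x_{1,n}^{**},\ldots,x_{m,n}^{**})\longrightarrow 0$ for every positive weak$^*$-null sequence $(x_{m,n}^{**})_{n=1}^\infty$ in $E_m^{**}$ and all bounded sequences $(x_{k,n}^{**})_{n=1}^\infty$ in $E_k^{**}$, $k=1,\ldots,m-1$. In particular, $A$ and its Aron-Berner extension $A^{*[m+1]}$ are almost Dunford-Pettis.
   Context: A sequence $(x_n)$ in a Banach lattice is disjoint if $|x_n|\wedge|x_k|=0$ for $n\ne k$. A Banach lattice $E$ has the positive Schur property if positive weakly null sequences in $E$ are norm null (equivalently, disjoint weakly null sequences, or disjoint positive weakly null sequences, are norm null). An $m$-linear form on Banach lattices is positive if it takes nonnegative values on tuples of positive elements, and regular if it is a difference of two positive $m$-linear forms (such forms are continuous). For Banach lattices $E_1,\ldots,E_m$ and a Banach space $G$, an $m$-linear operator $A\colon E_1\times\cdots\times E_m\to G$ is almost Dunford-Pettis if $(A(x_{1,n},\ldots,x_{m,n}))_{n=1}^\infty$ is norm null in $G$ whenever $(x_{j,n})_{n=1}^\infty$ is a disjoint weakly null sequence in $E_j$, $j=1,\ldots,m$. The weak$^*$ topology on $E_m^{**}$ is $\sigma(E_m^{**},E_m^* )$. The Aron-Berner extension $A^{*[m+1]}\colon E_1^{**}\times\cdots\times E_m^{**}\to\mathbb{R}$ of a continuous $m$-linear form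 $A$ on $E_1\times\cdots\times E_m$ is defined as follows. For $x_i^{**}\in E_i^{**}$ and a continuous $i$-linear form $B$ on $E_1\times\cdots\times E_i$, let $\overline{x_i^{**}}^{\theta}(B)$ be the continuous $(i-1)$-linear form on $E_1\times\cdots\times E_{i-1}$ (a real number if $i=1$) given by $\overline{x_i^{**}}^{\theta}(B)(x_1,\ldots,x_{i-1})=x_i^{**}\big(B(x_1,\ldots,x_{i-1},\bullet)\big)$, where $B(x_1,\ldots,x_{i-1},\bullet)\in E_i^*$ is the functional $x_i\mapsto B(x_1,\ldots,x_i)$. Then $$A^{*[m+1]}(x_1^{**},\ldots,x_m^{**})=\big(\overline{x_1^{**}}^{\theta}\circ\cdots\circ\overline{x_m^{**}}^{\theta}\big)(A).$$ *)

(* Defs.v *)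
From HB Require Import structures.
From mathcomp Require Import all_boot all_order all_algebra.
From mathcomp Require Import mathcomp_extra boolp classical_sets functions.
From mathcomp Require Import reals topology normedtype sequences.
From mathcomp Require Import lra.

Set Implicit Arguments.
Unset Strict Implicit.
Unset Printing Implicit Defensive.

Import Order.TTheory GRing.Theory Num.Theory.
Import numFieldNormedType.Exports.

Local Open Scope classical_set_scope.
Local Open Scope ring_scope.

(* A Banach lattice over R. The lattice operations are fields of the mixin
   rather than inherited from Order.Lattice because the hierarchy of MathComp
   has no structure below which a normed module and an order can be joined
   (both are inherited by Num.NumDomain, which is already closed). In the last
   axiom, x \/ - x is the absolute value of x in the lattice. *)
HB.mixin Record isBanachLattice (R : realType) E
    of CompleteNormedModule R E := {
  bl_le : rel E;
  bl_meet : E -> E -> E;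
  bl_join : E -> E -> E;
  bl_lexx : reflexive bl_le;
  bl_le_anti : antisymmetric bl_le;
  bl_le_trans : transitive bl_le;
  bl_lexI : forall x y z, bl_le x (bl_meet y z) = bl_le x y && bl_le x z;
  bl_leUx : forall x y z, bl_le (bl_join x y) z = bl_le x z && bl_le y z;
  bl_leD : forall x y z, bl_le x y -> bl_le (x + z) (y + z);
  bl_leZ : forall (a : R) x y, 0 <= a -> bl_le x y -> bl_le (a *: x) (a *: y);
  bl_le_norm : forall x y,
    bl_le (bl_join x (- x)) (bl_join y (- y)) -> `|x| <= `|y|
}.

#[short(type="banachLatticeType")]
HB.structure Definition BanachLattice (R : realType) :=
  {E of CompleteNormedModule R E & isBanachLattice R E}.

(* From here on the order of a Banach lattice is the one of the Order library,
   so that <=, Order.meet and Order.join and their theory apply. *)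
HB.instance Definition _ (R : realType) (E : banachLatticeType R) :=
  Order.Le_isPOrder.Build ring_display (BanachLattice.sort E)
    bl_lexx bl_le_anti bl_le_trans.
HB.instance Definition _ (R : realType) (E : banachLatticeType R) :=
  Order.POrder_MeetJoin_isLattice.Build ring_display (BanachLattice.sort E)
    bl_lexI bl_leUx.

Section RieszTheory.
Variables (R : realType) (E : banachLatticeType R).
Implicit Types (x y z : E) (a : R).
Local Notation "x `|` y" := (Order.join x y).
Local Notation "x `&` y" := (Order.meet x y).

(* the modulus and the positive part; `|x| remains the norm *)
Definition labs x : E := x `|` - x.
Definition lpos x : E := x `|` 0.

Lemma lat_leD2r z x y : (x + z <= y + z) = (x <= y).
Proof.
apply/idP/idP => [h|]; last exact: bl_leD.
by have := bl_leD _ _ (- z) h; rewrite !addrK.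
Qed.

Lemma lat_leD x y z t : x <= y -> z <= t -> x + z <= y + t.
Proof.
move=> xy zt; apply: (@le_trans _ _ (y + z)); first by rewrite lat_leD2r.
by rewrite ![y + _]addrC lat_leD2r.
Qed.

Lemma lat_subr_ge0 x y : (0 <= y - x) = (x <= y).
Proof. by rewrite -(lat_leD2r x 0) subrK add0r. Qed.

Lemma lat_addr_ge0 x y : 0 <= x -> 0 <= y -> 0 <= x + y.
Proof. by move=> x0 y0; rewrite -[0]addr0; exact: lat_leD. Qed.

Lemma lat_leZ a x y : 0 <= a -> x <= y -> a *: x <= a *: y.
Proof. exact: bl_leZ. Qed.

Lemma lat_scale_ge0 a x : 0 <= a -> 0 <= x -> 0 <= a *: x.
Proof. by move=> a0 /(lat_leZ a0); rewrite scaler0. Qed.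

Lemma lat_leBlDr x y z : (x - z <= y) = (x <= y + z).
Proof. by rewrite -(lat_leD2r z (x - z)) subrK. Qed.

Lemma lat_leN2 x y : (- x <= - y) = (y <= x).
Proof. by rewrite -(lat_subr_ge0 (- x)) opprK addrC lat_subr_ge0. Qed.

Lemma lat_joinDr z x y : (x `|` y) + z = (x + z) `|` (y + z).
Proof.
apply/eqP; rewrite eq_le leUx !lat_leD2r leUl leUr andbT.
rewrite -(lat_leD2r (- z) ((x `|` y) + z)) addrK leUx.
by rewrite -(lat_leD2r z x) -(lat_leD2r z y) !subrK leUl leUr.
Qed.

Lemma lpos_ge0 x : 0 <= lpos x. Proof. exact: leUr. Qed.

Lemma lposB x : x = lpos x - lpos (- x).
Proof.
apply/eqP; rewrite eq_sym subr_eq /lpos addrC lat_joinDr addNr add0r.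
by rewrite joinC.
Qed.

Lemma ge0_labs x : 0 <= x -> labs x = x.
Proof.
move=> x0; apply/join_idPl; apply: (le_trans _ x0).
by rewrite -[leRHS]oppr0 lat_leN2.
Qed.

Lemma le_labs x : x <= labs x. Proof. exact: leUl. Qed.

Lemma leN_labs x : - x <= labs x. Proof. exact: leUr. Qed.

Lemma labs_ge0 x : 0 <= labs x.
Proof.
have h : 0 <= labs x + labs x.
  by rewrite -(subrr x); apply: lat_leD; rewrite ?le_labs ?leN_labs.
suff -> : labs x = 2^-1 *: (labs x + labs x).
  by apply: lat_scale_ge0; rewrite ?invr_ge0.
by rewrite -mulr2n -(scaler_nat 2 (labs x)) scalerA mulVf ?scale1r// pnatr_eq0.
Qed.

Lemma labsN x : labs (- x) = labs x.
Proof. by rewrite /labs opprK joinC. Qed.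

Lemma labs_le x y : (labs x <= y) = (x <= y) && (- x <= y).
Proof. exact: leUx. Qed.

Lemma lpos_le_labs x : lpos x <= labs x.
Proof. by rewrite leUx le_labs labs_ge0. Qed.

Lemma lposD x : lpos x + lpos (- x) = labs x.
Proof.
have e : x + lpos (- x) = lpos x by rewrite {1}(lposB x) subrK.
rewrite {1}/lpos lat_joinDr e add0r; apply/eqP; rewrite eq_le leUx.
rewrite lpos_le_labs -{1}labsN lpos_le_labs labs_le /=; apply/andP; split.
  by apply: (@le_trans _ _ (lpos x)); exact: leUl.
by apply: (@le_trans _ _ (lpos (- x))); [exact: leUl|exact: leUr].
Qed.

Lemma le_norm x y : labs x <= labs y -> `|x| <= `|y|.
Proof. exact: bl_le_norm. Qed.

Lemma norm_labs x : `|labs x| = `|x|.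
Proof. by apply/eqP; rewrite eq_le !le_norm// ?(ge0_labs (labs_ge0 x)). Qed.

Lemma norm_lpos x : `|lpos x| <= `|x|.
Proof. by apply: le_norm; rewrite (ge0_labs (lpos_ge0 x)) lpos_le_labs. Qed.

(* Riesz decomposition property *)
Lemma lat_decomp x y z : 0 <= x -> 0 <= y -> 0 <= z -> z <= x + y ->
  exists2 u, 0 <= u <= x & 0 <= z - u <= y.
Proof.
move=> x0 y0 z0 zxy; exists (z `&` x); first by rewrite lexI z0 x0 leIr.
have zy : z - y <= z `&` x.
  by rewrite lexI !lat_leBlDr zxy andbT -lat_subr_ge0 addrC addKr.
by rewrite lat_subr_ge0 leIl lat_leBlDr addrC -lat_leBlDr.
Qed.

End RieszTheory.

Section Dual.
Variables (R : realType) (E : banachLatticeType R).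

Definition dual_pred : {pred E -> R^o} :=
  [pred f : E -> R^o | `[< linear f /\ continuous f >]].

Record dual := Dual { dual_val :> E -> R^o; _ : dual_val \in dual_pred }.

HB.instance Definition _ := [isSub for dual_val].
HB.instance Definition _ := [Choice of dual by <:].

Lemma dual_submod_closed : submod_closed dual_pred.
Proof.
split=> [|a f g /asboolP[lf cf] /asboolP[lg cg]]; apply/asboolP.
  split=> [a x y|]; last exact: cst_continuous.
  by rewrite /= scaler0 addr0.
split=> [b x y|x].
  by rewrite !fctE lf lg !scalerDr !scalerA [b * a]mulrC addrACA.
by apply: cvgD; [apply: cvgZ; [exact: cvg_cst|exact: cf]|exact: cg].
Qed.

HB.instance Definition _ :=
  GRing.isSubmodClosed.Build R (E -> R^o) dual_pred dual_submod_closed.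
HB.instance Definition _ := [SubChoice_isSubLmodule of dual by <:].

Implicit Types (f g h : dual) (x y z : E).

Fact dual_linear f : linear (dual_val f).
Proof. by case: f => f /= /asboolP[]. Qed.

HB.instance Definition _ f :=
  GRing.isLinear.Build R E R^o _ (dual_val f) (dual_linear f).

Lemma dual_continuous f : continuous (dual_val f).
Proof. by case: f => f /= /asboolP[]. Qed.

Lemma dualP f g : (forall x, f x = g x) -> f = g.
Proof. by move=> fg; apply/val_inj/funext. Qed.

Lemma dual_addE f g x : (f + g) x = f x + g x. Proof. by []. Qed.
Lemma dual_oppE f x : (- f) x = - f x. Proof. by []. Qed.
Lemma dual_scaleE (a : R) f x : (a *: f) x = a * f x. Proof. by []. Qed.
Lemma dual_zeroE x : (0 : dual) x = 0. Proof. by []. Qed.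

Lemma bounded_dual (f : E -> R) :
    (forall x y, f (x + y) = f x + f y) ->
    (forall (a : R) x, f (a *: x) = a * f x) ->
    (exists C, forall x, `|f x| <= C * `|x|) ->
   exists g : dual, forall x, g x = f x.
Proof.
move=> fD fZ [C fC].
have lf : linear (f : E -> R^o) by move=> a x y; rewrite fD fZ.
pose L := GRing.isLinear.Build R E R^o _ (f : E -> R^o) lf.
pose lfm : {linear E -> R^o} := HB.pack (f : E -> R^o) L.
have fP : (f : E -> R^o) \in dual_pred.
  apply/asboolP; split=> //.
  apply: (@bounded_linear_continuous _ _ _ lfm).
  apply/linear_boundedP; near=> r => x.
  rewrite (le_trans (fC x))// ler_wpM2r//.
  by near: r; apply: nbhs_pinfty_ge; exact: num_real.
by exists (Dual fP).
Unshelve. all: by end_near. Qed.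

Definition dual_norm f : R := sup [set `|f x| | x in [set x | `|x| <= 1]].

Let dual_bdd f : exists2 C : R, 0 <= C & forall x, `|f x| <= C * `|x|.
Proof.
have /linear_bounded_continuous/linear_boundedP/pinfty_ex_gt0[C C0 fC] :=
  @dual_continuous f.
by exists C; rewrite // ltW.
Qed.

Let has_sup_dual f : has_sup [set `|f x| | x in [set x | `|x| <= 1]].
Proof.
split; first by exists `|f 0|, 0 => //=; rewrite normr0.
have [C C0 fC] := dual_bdd f; exists C => _ [x /= x1 <-].
by rewrite (le_trans (fC x))// ler_piMr.
Qed.

Lemma dual_norm_ge0 f : 0 <= dual_norm f.
Proof.
apply: le_trans (normr_ge0 (f 0)) _; apply: sup_upper_bound => //.
by exists 0 => //=; rewrite normr0.
Qed.

Lemma le_dual_norm f x : `|f x| <= dual_norm f * `|x|.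
Proof.
have [->|x0] := eqVneq x 0; first by rewrite linear0 !normr0 mulr0.
have nx0 : 0 < `|x| by rewrite normr_gt0.
have /= := sup_upper_bound (has_sup_dual f).
move=> /(_ `|f (`|x|^-1 *: x)|); rewrite -/(dual_norm f) => h.
rewrite -ler_pdivrMr//; apply: le_trans (h _); last first.
  by exists (`|x|^-1 *: x) => //=; rewrite normrZ normfV normr_id mulVf ?gt_eqF.
by rewrite linearZ/= normrZ normfV normr_id mulrC.
Qed.

Lemma dual_norm_le f C : 0 <= C -> (forall x, `|f x| <= C * `|x|) ->
  dual_norm f <= C.
Proof.
move=> C0 fC; apply: ge_sup; first by case: (has_sup_dual f).
by move=> _ [x /= x1 <-]; rewrite (le_trans (fC x))// ler_piMr.
Qed.

Fact dual_normD f g : dual_norm (f + g) <= dual_norm f + dual_norm g.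
Proof.
apply: dual_norm_le => [|x]; first by rewrite addr_ge0 ?dual_norm_ge0.
by rewrite (le_trans (ler_normD _ _))// mulrDl lerD ?le_dual_norm.
Qed.

Fact dual_normZ (a : R) f : dual_norm (a *: f) = `|a| * dual_norm f.
Proof.
have le b g : dual_norm (b *: g) <= `|b| * dual_norm g.
  apply: dual_norm_le => [|x]; first by rewrite mulr_ge0 ?dual_norm_ge0.
  by rewrite dual_scaleE normrM -mulrA ler_wpM2l ?le_dual_norm.
apply/eqP; rewrite eq_le le/=; have [->|a0] := eqVneq a 0.
  by rewrite normr0 mul0r dual_norm_ge0.
rewrite -ler_pdivlMl ?normr_gt0// -normfV.
by apply: le_trans (le _ _); rewrite scalerA mulVf// scale1r.
Qed.

Fact dual_norm_eq0 f : dual_norm f = 0 -> f = 0.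
Proof.
move=> f0; apply: dualP => x; apply/eqP; rewrite -normr_le0.
by rewrite (le_trans (le_dual_norm f x))// f0 mul0r.
Qed.

HB.instance Definition _ :=
  Lmodule_isNormed.Build R dual dual_normD dual_normZ dual_norm_eq0.

Lemma dual_normE f : `|f| = dual_norm f. Proof. by []. Qed.

Lemma ler_dual f x : `|f x| <= `|f| * `|x|. Proof. exact: le_dual_norm. Qed.

Fact dual_complete (F : set_system dual) : ProperFilter F -> cauchy F -> cvg F.
Proof.
move=> FF /cauchyP cF.
have Fe e : 0 < e ->
    exists f0 : dual, F [set f : dual | forall x, `|f0 x - f x| <= e * `|x|].
  move=> /cF[f0]; rewrite -ball_normE => Ff0; exists f0.
  apply: filterS Ff0 => f /= f0f x.
  by rewrite (le_trans (ler_dual (f0 - f) x))// ler_wpM2r// ltW.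
have Fcvg x : cvg ((fun f : dual => f x : R^o) @ F).
  apply: cauchy_cvg; apply: cauchy_exP => e e0.
  have x1 : 0 < `|x| + 1 by rewrite ltr_wpDl.
  have ex : e / (`|x| + 1) * `|x| < e.
    by rewrite -mulrA gtr_pMr// mulrC ltr_pdivrMr// mul1r ltrDl.
  have [f0 Ff0] := Fe _ (divr_gt0 e0 x1); exists (f0 x).
  suff : F [set f : dual | ball (f0 x : R^o) e (f x)] by [].
  apply: filterS Ff0 => f /(_ x) f0f; rewrite -ball_normE.
  exact: le_lt_trans f0f ex.
pose l x : R := lim ((fun f : dual => f x : R^o) @ F).
have Fl x : (fun f : dual => f x : R^o) @ F --> (l x : R^o) by exact: Fcvg.
have le e : 0 < e -> exists f0 : dual,
    (forall x, `|f0 x - l x| <= e * `|x|) /\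
    F [set f : dual | forall x, `|f0 x - f x| <= e * `|x|].
  move=> /Fe[f0 Ff0]; exists f0; split=> // x.
  have cv : (fun f : dual => `|f0 x - f x| : R^o) @ F --> (`|f0 x - l x| : R^o).
    by apply: cvg_norm; apply: cvgB; [exact: cvg_cst|exact: Fl].
  by apply: (cvgr_to_le cv); apply: filterS Ff0 => f.
have [|||g gE] := @bounded_dual l; last 1 first.
- apply/cvg_ex; exists g; apply/cvgrPdist_le => e e0.
  have [f0 [f0l Ff0]] := le _ (divr_gt0 e0 (ltr0n R 2)).
  apply: filterS Ff0 => f f0f; apply: dual_norm_le => [|x]; first exact: ltW.
  have -> : (g - f) x = (f0 x - f x) - (f0 x - l x).
    by rewrite dual_addE dual_oppE gE; lra.
  rewrite (le_trans (ler_normB _ _))// [e]splitr mulrDl.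
  by rewrite lerD.
- move=> x y; apply: (norm_cvg_unique (Fl (x + y))).
  have -> : (fun f : dual => f (x + y) : R^o) = (fun f => f x + f y : R^o).
    by apply/funext => f; rewrite linearD.
  by apply: cvgD; exact: Fl.
- move=> a x; apply: (norm_cvg_unique (Fl (a *: x))).
  have -> : (fun f : dual => f (a *: x) : R^o) = (fun f => a *: (f x : R^o)).
    by apply/funext => f; rewrite linearZ.
  by apply: cvgZ; [exact: cvg_cst|exact: Fl].
- have [f0 [f0l _]] := le _ ltr01; exists (`|f0| + 1) => x.
  have -> : l x = f0 x - (f0 x - l x) by lra.
  rewrite (le_trans (ler_normB _ _))// mulrDl lerD//; exact: ler_dual.
Qed.

HB.instance Definition _ := Uniform_isComplete.Build dual dual_complete.

End Dual.

(* The dual is a Banach lattice for the order given by the positive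
   functionals; suprema are computed by the Riesz-Kantorovich formula *)
Section DualLattice.
Variables (R : realType) (E : banachLatticeType R).
Implicit Types (f g h : dual E) (x y z : E).

Definition dual_le f g : bool := `[< forall x, 0 <= x -> f x <= g x >].

Lemma dual_leP f g : reflect (forall x, 0 <= x -> f x <= g x) (dual_le f g).
Proof. exact: asboolP. Qed.

Fact dual_lexx : reflexive dual_le.
Proof. by move=> f; apply/dual_leP. Qed.

Lemma eq_dual_cone f g : (forall x, 0 <= x -> f x = g x) -> f = g.
Proof.
by move=> fg; apply: dualP => x; rewrite (lposB x) !linearB/= !fg ?lpos_ge0.
Qed.

Fact dual_le_anti : antisymmetric dual_le.
Proof.
move=> f g /andP[/dual_leP fg /dual_leP gf]; apply: eq_dual_cone => x x0.
by apply/eqP; rewrite eq_le fg ?gf.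
Qed.

Fact dual_le_trans : transitive dual_le.
Proof.
move=> g f h /dual_leP fg /dual_leP gh; apply/dual_leP => x x0.
exact: le_trans (fg _ x0) (gh _ x0).
Qed.

Lemma cone_extension (p : E -> R) (C : R) :
    (forall x y, 0 <= x -> 0 <= y -> p (x + y) = p x + p y) ->
    (forall (a : R) x, 0 <= a -> 0 <= x -> p (a *: x) = a * p x) ->
    (forall x, 0 <= x -> `|p x| <= C * `|x|) ->
  exists f, forall x, 0 <= x -> f x = p x.
Proof.
move=> pD pZ pC.
pose q x := p (lpos x) - p (lpos (- x)).
have pB u v s t : 0 <= u -> 0 <= v -> 0 <= s -> 0 <= t ->
    u - v = s - t -> p u - p v = p s - p t.
  move=> u0 v0 s0 t0 /eqP; rewrite subr_eq addrAC eq_sym subr_eq => /eqP e.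
  by have := congr1 p e; rewrite !pD//; lra.
have qE u v : 0 <= u -> 0 <= v -> q (u - v) = p u - p v.
  by move=> u0 v0; apply: pB => //; rewrite ?lpos_ge0// -lposB.
have p0 : p 0 = 0 by rewrite -(scale0r 0) pZ// mul0r.
have pq x : 0 <= x -> q x = p x.
  by move=> x0; have := qE x 0 x0 (lexx 0); rewrite subr0 p0 subr0.
have [|||f fE] := @bounded_dual _ E q; last by exists f => x x0; rewrite fE pq.
- move=> x y; rewrite {1}(lposB x) {1}(lposB y) addrACA -opprD qE.
  + by rewrite !pD ?lpos_ge0// /q; lra.
  + by rewrite lat_addr_ge0 ?lpos_ge0.
  + by rewrite lat_addr_ge0 ?lpos_ge0.
- move=> a x; have [a0|a0] := leP 0 a.
    rewrite {1}(lposB x) scalerBr qE ?lat_scale_ge0 ?lpos_ge0//.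
    by rewrite !pZ ?lpos_ge0// -mulrBr.
  have Na0 : 0 <= - a by rewrite oppr_ge0 ltW.
  have -> : a *: x = (- a) *: lpos (- x) - (- a) *: lpos x.
    by rewrite -scalerBr scaleNr -scalerN opprB -lposB.
  rewrite qE ?lat_scale_ge0 ?lpos_ge0// !pZ ?lpos_ge0//.
  by rewrite /q; lra.
- have C0 x : 0 <= x -> `|p x| <= `|C| * `|x|.
    by move=> /pC/le_trans; apply; rewrite ler_wpM2r// ler_norm.
  exists (`|C| + `|C|) => x.
  rewrite /q (le_trans (ler_normB _ _))// mulrDl lerD//.
    by rewrite (le_trans (C0 _ (lpos_ge0 _)))// ler_wpM2l// norm_lpos.
  rewrite (le_trans (C0 _ (lpos_ge0 _)))// ler_wpM2l//.
  by rewrite -(normrN x) norm_lpos.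
Qed.

Definition seg_sup f x : R := sup [set f z | z in [set z | 0 <= z <= x]].

Let seg_has_sup f x : 0 <= x -> has_sup [set f z | z in [set z | 0 <= z <= x]].
Proof.
move=> x0; split; first by exists (f 0), 0 => //=; rewrite lexx.
exists (`|f| * `|x|) => _ [z /= /andP[z0 zx] <-].
rewrite (le_trans (ler_norm _))// (le_trans (ler_dual _ _))// ler_wpM2l//.
by apply: le_norm; rewrite !ge0_labs// (le_trans z0).
Qed.

Let seg_sup_ub f x z : 0 <= z -> z <= x -> f z <= seg_sup f x.
Proof.
move=> z0 zx; apply: (sup_upper_bound (seg_has_sup f (le_trans z0 zx))).
by exists z => //=; rewrite z0.
Qed.

Let seg_sup_ge0 f x : 0 <= x -> 0 <= seg_sup f x.
Proof. by move=> x0; have := seg_sup_ub f (lexx 0) x0; rewrite linear0. Qed.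

Let seg_sup_le f x c : 0 <= x ->
  (forall z, 0 <= z -> z <= x -> f z <= c) -> seg_sup f x <= c.
Proof.
move=> x0 fc; apply: ge_sup; first by case: (seg_has_sup f x0).
by move=> _ [z /= /andP[z0 zx] <-]; exact: fc.
Qed.

Let seg_supD f x y : 0 <= x -> 0 <= y ->
  seg_sup f (x + y) = seg_sup f x + seg_sup f y.
Proof.
move=> x0 y0; apply/eqP; rewrite eq_le; apply/andP; split.
  apply: seg_sup_le => [|z z0 zxy]; first exact: lat_addr_ge0.
  have [u /andP[u0 ux] /andP[v0 vy]] := lat_decomp x0 y0 z0 zxy.
  have -> : f z = f u + f (z - u) by rewrite linearB/=; lra.
  by rewrite lerD ?seg_sup_ub.
rewrite -lerBrDr; apply: seg_sup_le => // u u0 ux.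
rewrite lerBrDr -lerBrDl; apply: seg_sup_le => // v v0 vy.
rewrite lerBrDl -linearD seg_sup_ub//; first exact: lat_addr_ge0.
exact: lat_leD.
Qed.

Let seg_supZ f (a : R) x : 0 <= a -> 0 <= x ->
  seg_sup f (a *: x) = a * seg_sup f x.
Proof.
have le b y : 0 <= b -> 0 <= y -> b * seg_sup f y <= seg_sup f (b *: y).
  rewrite le_eqVlt => /orP[/eqP <-|b0] y0.
    rewrite mul0r scale0r.
    by rewrite seg_sup_ge0.
  rewrite mulrC -ler_pdivlMr//; apply: seg_sup_le => // z z0 zy.
  rewrite ler_pdivlMr// mulrC.
  have -> : b * f z = f (b *: z) by rewrite linearZ.
  by apply: seg_sup_ub; [exact/lat_scale_ge0/z0/ltW|exact/lat_leZ/zy/ltW].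
rewrite le_eqVlt => /orP[/eqP <-|a0] x0.
  rewrite mul0r scale0r; apply/eqP; rewrite eq_le; apply/andP; split.
    apply: seg_sup_le => // z z0 z0'.
    suff -> : z = 0 by rewrite linear0.
    by apply/eqP; rewrite eq_le z0 z0'.
  exact: seg_sup_ge0.
apply/eqP; rewrite eq_le le ?(ltW a0)// andbT.
rewrite -ler_pdivrMl//.
have ax : 0 <= a *: x by apply: lat_scale_ge0; rewrite // ltW.
rewrite (le_trans (le _ _ _ ax)) ?invr_ge0 ?(ltW a0)//.
by rewrite scalerA mulVf ?gt_eqF// scale1r.
Qed.

Let dual_pos_exists f :
  exists g : dual E, forall x, 0 <= x -> g x = seg_sup f x.
Proof.
apply: (@cone_extension _ `|f|); [exact: seg_supD|exact: seg_supZ|].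
move=> x x0; rewrite ger0_norm ?seg_sup_ge0//.
apply: seg_sup_le => // z z0 zx.
rewrite (le_trans (ler_norm _))// (le_trans (ler_dual _ _))// ler_wpM2l//.
by apply: le_norm; rewrite !ge0_labs.
Qed.

Definition dual_pos f : dual E := sval (cid (dual_pos_exists f)).

Lemma dual_posE f x : 0 <= x ->
  dual_pos f x = sup [set f z | z in [set z | 0 <= z <= x]].
Proof. exact: (svalP (cid (dual_pos_exists f))). Qed.

Lemma dual_pos_le f g : dual_le (dual_pos f) g = dual_le f g && dual_le 0 g.
Proof.
apply/dual_leP/andP => [fg|[/dual_leP fg /dual_leP g0] x x0].
  split; apply/dual_leP => x x0; apply: le_trans (fg _ x0); rewrite dual_posE//.
    exact: seg_sup_ub.
  exact: seg_sup_ge0.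
rewrite dual_posE//; apply: seg_sup_le => // z z0 zx.
rewrite (le_trans (fg _ z0))// -subr_ge0 -linearB/=.
by apply: (g0 (x - z)); rewrite lat_subr_ge0.
Qed.

Definition dual_join f g : dual E := f + dual_pos (g - f).
Definition dual_meet f g : dual E := f - dual_pos (f - g).

Fact dual_leD f g h : dual_le f g -> dual_le (f + h) (g + h).
Proof.
by move=> /dual_leP fg; apply/dual_leP => x x0; rewrite !dual_addE lerD2r fg.
Qed.

Fact dual_leZ (a : R) f g : 0 <= a -> dual_le f g -> dual_le (a *: f) (a *: g).
Proof.
move=> a0 /dual_leP fg; apply/dual_leP => x x0.
by rewrite !dual_scaleE ler_wpM2l ?fg.
Qed.

Let dual_leBr f g h : dual_le (f + g) h = dual_le g (h - f).
Proof.
apply/dual_leP/dual_leP => fgh x x0; have := fgh x x0;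
by rewrite !dual_addE !dual_oppE; lra.
Qed.

Fact dual_leUx f g h : dual_le (dual_join f g) h = dual_le f h && dual_le g h.
Proof.
rewrite /dual_join dual_leBr dual_pos_le andbC -!dual_leBr addr0.
by rewrite addrC subrK.
Qed.

Let dual_leN f g : dual_le (- f) (- g) = dual_le g f.
Proof.
by apply/dual_leP/dual_leP => fg x x0; have := fg x x0;
  rewrite !dual_oppE lerN2.
Qed.

Fact dual_lexI f g h : dual_le f (dual_meet g h) = dual_le f g && dual_le f h.
Proof.
rewrite -dual_leN.
have -> : - dual_meet g h = dual_join (- g) (- h).
  by rewrite /dual_meet /dual_join opprB opprK addrC [in RHS](addrC (- h)).
by rewrite dual_leUx !dual_leN.
Qed.

Fact dual_le_abs_norm f g :
  dual_le (dual_join f (- f)) (dual_join g (- g)) -> `|f| <= `|g|.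
Proof.
move=> /dual_leP fg; apply: dual_norm_le => // x.
have fN : dual_le f (dual_join f (- f)) && dual_le (- f) (dual_join f (- f)).
  by rewrite -dual_leUx dual_lexx.
have fx : `|f x| <= dual_join f (- f) (labs x).
  rewrite -lposD linearD {1}(lposB x) linearB/=.
  move: fN => /andP[/dual_leP f1 /dual_leP f2].
  have := f1 _ (lpos_ge0 x); have := f1 _ (lpos_ge0 (- x)).
  have := f2 _ (lpos_ge0 x); have := f2 _ (lpos_ge0 (- x)).
  rewrite !dual_oppE ler_norml; lra.
apply: (le_trans fx); apply: (le_trans (fg _ (labs_ge0 x))).
rewrite /dual_join dual_addE dual_posE ?labs_ge0// -lerBrDl.
apply: seg_sup_le => [|z z0 zx]; first exact: labs_ge0.
have -> : (- g - g : dual E) z = g (labs x - z - z) - g (labs x).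
  by rewrite dual_addE !dual_oppE !linearB/=; lra.
rewrite lerD2r (le_trans (ler_norm _))// (le_trans (ler_dual _ _))//.
rewrite ler_wpM2l//; apply: le_norm; rewrite labs_le; apply/andP; split.
  rewrite -addrA -opprD lat_leBlDr -[leLHS]addr0.
  by apply: lat_leD => //; exact: lat_addr_ge0.
rewrite !opprB addrA lat_leBlDr; exact: lat_leD.
Qed.

HB.instance Definition _ := isBanachLattice.Build R (dual E)
  dual_lexx dual_le_anti dual_le_trans dual_lexI dual_leUx dual_leD dual_leZ
  dual_le_abs_norm.

HB.instance Definition _ := Order.Lattice.copy (dual E)
  (BanachLattice.sort (dual E : banachLatticeType R)).

Lemma le_dualP f g : reflect (forall x, 0 <= x -> f x <= g x) (f <= g).
Proof. exact: dual_leP. Qed.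

Lemma dual_joinE f g x : 0 <= x -> Order.join f g x =
  f x + sup [set (g - f) z | z in [set z | 0 <= z <= x]].
Proof.
by move=> x0; rewrite -dual_posE.
Qed.

End DualLattice.

Section Sequences.
Variables (R : realType) (E : banachLatticeType R).
Implicit Types x : nat -> E.

Definition positive_seq x : Prop := forall n, 0 <= x n.

Definition disjoint_seq x : Prop :=
  forall n k, n != k -> Order.meet (labs (x n)) (labs (x k)) = 0.

Definition weakly_null x : Prop :=
  forall f : dual E, (fun n => f (x n)) @ \oo --> (0 : R).

Definition weak_star_null (u : nat -> dual E) : Prop :=
  forall a : E, (fun n => u n a) @ \oo --> (0 : R).

Definition positive_schur : Prop :=
  forall x, positive_seq x -> weakly_null x -> x @ \oo --> (0 : E).

End Sequences.
Arguments positive_schur {R} E.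
Notation bidual E := (dual (dual E)).

Section MultilinearMaps.
Variables (R : realType) (m : nat) (E : 'I_m -> banachLatticeType R).

Definition multilinear (G : lmodType R) (A : (forall i, E i) -> G) : Prop :=
  forall (i : 'I_m) (x : forall j, E j), linear (fun t => A (dfwith x i t)).

Definition positive_form (A : (forall i, E i) -> R) : Prop :=
  forall x : forall i, E i, (forall i, 0 <= x i) -> 0 <= A x.

Definition regular_form (A : (forall i, E i) -> R) : Prop :=
  exists B C : (forall i, E i) -> R,
    [/\ multilinear B /\ positive_form B, multilinear C /\ positive_form C
      & A = B \- C].

Definition almost_dunford_pettis (G : completeNormedModType R)
    (A : (forall i, E i) -> G) : Prop :=
  multilinear A /\
  forall x : forall i, nat -> E i,
    (forall i, disjoint_seq (x i) /\ weakly_null (x i)) ->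
    (fun n => A (fun i => x i n)) @ \oo --> (0 : G).
End MultilinearMaps.

Section AronBerner.
Variable R : realType.

(* (y_0, .., y_(m-1), t); lift ord_max is the inclusion of 'I_m in 'I_m.+1 *)
Definition tuple_snoc m (E : 'I_m.+1 -> banachLatticeType R)
    (y : forall j : 'I_m, E (lift ord_max j)) (t : E ord_max)
    (i : 'I_m.+1) : E i :=
  match unliftP ord_max i in unlift_spec _ _ u return E i with
  | UnliftSome j e => ecast i (E i) (esym e) (y j)
  | UnliftNone e => ecast i (E i) (esym e) t
  end.

Lemma tuple_snoc_max m E y t : @tuple_snoc m E y t ord_max = t.
Proof.
rewrite /tuple_snoc; case: unliftP => [j e|e]; last by rewrite eq_axiomK.
by case/eqP: (neq_lift ord_max j).
Qed.

Lemma tuple_snoc_lift m E y t j : @tuple_snoc m E y t (lift ord_max j) = y j.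
Proof.
rewrite /tuple_snoc; case: unliftP => [k e|e]; last first.
  by case/eqP: (neq_lift ord_max j); rewrite e.
by have ejk := lift_inj e; subst k; rewrite eq_axiomK.
Qed.

(* f as an element of the dual, and the junk value 0 if f is not linear and
   continuous (see to_dualE). In the Aron-Berner extension of a continuous, in
   particular of a regular, multilinear form the junk value is never used. *)
Definition to_dual (E : banachLatticeType R) (f : E -> R) : dual E :=
  insubd (0 : dual E) (f : E -> R^o).

Lemma to_dualE (E : banachLatticeType R) (f : E -> R) :
  linear (f : E -> R^o) -> continuous f -> forall t, to_dual f t = f t.
Proof.
move=> lf cf t; rewrite /to_dual.
have fP : (f : E -> R^o) \in @dual_pred R E by apply/asboolP.
by rewrite -[LHS]/(val (insubd _ _) t) insubdK.
Qed.

(* From the m.+1-linear form B, the m-linear form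
   (y_0, .., y_(m-1)) |-> u (B (y_0, .., y_(m-1), -)) *)
Definition theta m (E : 'I_m.+1 -> banachLatticeType R) (u : bidual (E ord_max))
   (B : (forall i, E i) -> R) : (forall j : 'I_m, E (lift ord_max j)) -> R :=
  fun y => u (to_dual (fun t => B (tuple_snoc y t))).

(* theta (x_0) o .. o theta (x_(m-1)) applied to A: the last variable is
   extended first. A 0-linear form is its value at the empty tuple. *)
Fixpoint aron_berner m : forall (E : 'I_m -> banachLatticeType R),
    ((forall i, E i) -> R) -> (forall i, bidual (E i)) -> R :=
  match m with
  | 0 => fun E A _ => A (fun i => False_rect _ (notF (ltn_ord i)))
  | m'.+1 => fun E A x =>
      aron_berner (theta (x ord_max) A) (fun j => x (lift ord_max j))
  end.
End AronBerner.

(* Main.v *)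
(* Assume A positive and fix the last bidual variable u_n >= 0. By duality the
   value of the extension is nearly u_n (f_n) with f_n = A (y_n, -) for some
   bounded positive y_n in the original lattices, so it suffices that u_n tends
   to 0 uniformly on these functionals. By a disjointification argument this
   holds if every disjoint sequence g_n with 0 <= g_n <= f_n is norm null, hence,
   by the positive Schur property, if it is weakly null. For Phi >= 0 in the
   bidual, let phi_n be the restriction of Phi to the band of g_n. Then
   Phi (g_n) <= phi_n (A (y_n, -)), and the positive forms phi_n (A (., -)) have
   partial sums bounded by Phi (A (., -)). Such forms tend to 0 along bounded
   sequences, by induction on the number of variables and the positive Schur
   property. *)
Require Import Defs.
From HB Require Import structures.
From mathcomp Require Import all_boot all_order all_algebra.
From mathcomp Require Import mathcomp_extra boolp classical_sets functions.
From mathcomp Require Import reals topology normedtype sequences.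
From mathcomp Require Import lra.

Set Implicit Arguments.
Unset Strict Implicit.
Unset Printing Implicit Defensive.

Import Order.TTheory GRing.Theory Num.Theory.
Import numFieldNormedType.Exports.

Local Open Scope classical_set_scope.
Local Open Scope ring_scope.

Lemma le_cvg0 (R : realType) (a b : nat -> R) :
  (forall n, `|a n| <= b n) -> b @ \oo --> (0 : R) -> a @ \oo --> (0 : R).
Proof.
move=> ab b0; apply: norm_cvg0.
apply: (@squeeze_cvgr _ _ _ _ (fun=> 0) b); [|exact: cvg_cst|exact: b0].
by apply: nearW => n; rewrite normr_ge0 ab.
Qed.

(** * Disjointness, bands and positive functionals in Riesz spaces *)

Section Riesz.
Variables (R : realType) (E : banachLatticeType R).
Implicit Types (x y z d e f : E) (a : R).
Local Notation "x `|` y" := (Order.join x y).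
Local Notation "x `&` y" := (Order.meet x y).

(** Subtracting the meet [d] from [lpos x] leaves an upper bound of [x] and [0], so [d <= 0] by
    minimality of [lpos x]. *)
Lemma meet_lposN x : lpos x `&` lpos (- x) = 0.
Proof.
apply/eqP; rewrite eq_le lexI !lpos_ge0 !andbT; set d := _ `&` _.
have : lpos x <= lpos x - d.
  rewrite leUx lat_subr_ge0 leIl andbT.
  by rewrite {1}(lposB x) -lat_leN2 !opprB lat_leD2r leIr.
by rewrite -lat_subr_ge0 addrAC subrr add0r -[0 in X in X -> _]oppr0 lat_leN2.
Qed.

(** Riesz decomposition splits the left-hand side into a part below [x] and a part below [y]; both
    parts stay below [z]. *)
Lemma meetDl_le x y z : 0 <= x -> 0 <= y -> 0 <= z ->
  (x + y) `&` z <= x `&` z + y `&` z.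
Proof.
move=> x0 y0 z0; set w : E := _ `&` z.
have w0 : 0 <= w by rewrite /w lexI z0 lat_addr_ge0.
have [u /andP[u0 ux] /andP[v0 vy]] := lat_decomp x0 y0 w0 (leIl _ _).
have -> : w = u + (w - u) by rewrite addrC subrK.
have wz : w <= z := leIr _ _.
apply: lat_leD; rewrite lexI ?ux ?vy /= (le_trans _ wz)//.
  by rewrite -lat_subr_ge0.
by rewrite lat_leBlDr -[leLHS]addr0 lat_leD.
Qed.

Lemma meet0D x y z : 0 <= x -> 0 <= y -> 0 <= z ->
  x `&` z = 0 -> y `&` z = 0 -> (x + y) `&` z = 0.
Proof.
move=> x0 y0 z0 xz yz; apply/eqP; rewrite eq_le lexI z0 lat_addr_ge0// !andbT.
by rewrite (le_trans (meetDl_le _ _ _))// xz yz addr0.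
Qed.

Lemma scale_le1 a x : 0 <= x -> a <= 1 -> a *: x <= x.
Proof.
move=> x0 a1; rewrite -lat_subr_ge0 -{1}[x]scale1r -scalerBl.
by rewrite lat_scale_ge0// subr_ge0.
Qed.

Lemma meet0Z a x y : 0 <= a -> 0 <= x -> 0 <= y ->
  x `&` y = 0 -> (a *: x) `&` y = 0.
Proof.
(* Both [a / b] and [1 / b] are at most 1, so the meet divided by [b] lies below [x] and below
   [y]. *)
move=> a0 x0 y0 xy; pose b := a + 1.
have b0 : 0 < b by rewrite /b ltr_wpDl.
have b1 : b^-1 <= 1 by rewrite invf_le1// /b lerDr.
apply/eqP; rewrite eq_le lexI y0 lat_scale_ge0// !andbT.
suff h : b^-1 *: ((a *: x) `&` y) <= 0.
  by have := lat_leZ (ltW b0) h; rewrite scalerA mulfV ?gt_eqF// scale1r scaler0.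
rewrite -xy lexI; apply/andP; split.
  apply: (@le_trans _ _ (b^-1 *: (a *: x))).
    by apply: lat_leZ; rewrite ?leIl// invr_ge0 ltW.
  rewrite scalerA scale_le1// mulrC ler_pdivrMr// mul1r /b lerDl//.
apply: (@le_trans _ _ (b^-1 *: y)); last exact: scale_le1.
by apply: lat_leZ; rewrite ?leIr// invr_ge0 ltW.
Qed.

(** The vector [x + y - z] lies below [x] and below [y], hence below their meet. *)
Lemma leD_disjoint x y z : x `&` y = 0 -> x <= z -> y <= z -> x + y <= z.
Proof.
move=> xy xz yz; suff : x + y - z <= x `&` y by rewrite xy lat_leBlDr add0r.
by rewrite lexI !lat_leBlDr lat_leD// addrC lat_leD.
Qed.

Lemma meet0_le x y x' y' : 0 <= x' -> 0 <= y' -> x' <= x -> y' <= y ->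
  x `&` y = 0 -> x' `&` y' = 0.
Proof.
move=> x0 y0 xx yy xy; apply/eqP; rewrite eq_le lexI x0 y0 !andbT -xy.
exact: leI2.
Qed.

Lemma lpos_le x y : x <= y -> lpos x <= lpos y.
Proof. by move=> xy; apply: leU2. Qed.

Lemma lposZ a x : 0 <= a -> lpos (a *: x) = a *: lpos x.
Proof.
have le b y : 0 <= b -> lpos (b *: y) <= b *: lpos y.
  by move=> b0; rewrite leUx lat_scale_ge0 ?lpos_ge0// andbT lat_leZ// leUl.
move=> a0; apply/eqP; rewrite eq_le le//=.
have [->|an0] := eqVneq a 0; first by rewrite !scale0r lpos_ge0.
have ai0 : 0 <= a^-1 by rewrite invr_ge0.
have := lat_leZ a0 (le a^-1 (a *: x) ai0).
by rewrite !scalerA mulVf// mulfV// !scale1r.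
Qed.

Lemma dual_ge0 (f : dual E) x : 0 <= f -> 0 <= x -> 0 <= f x.
Proof. by move=> /le_dualP/(_ x). Qed.

Lemma dual_homo (f : dual E) x y : 0 <= f -> x <= y -> f x <= f y.
Proof.
move=> f0 xy; rewrite -subr_ge0 -linearB/=; apply: dual_ge0 => //.
by rewrite lat_subr_ge0.
Qed.

Lemma ge0_weakly_null (x : nat -> E) :
  (forall f : dual E, 0 <= f -> (fun n => f (x n)) @ \oo --> (0 : R)) ->
  weakly_null x.
Proof.
move=> h f; have -> : (fun n => f (x n)) =
    (fun n => (lpos f) (x n) - (lpos (- f)) (x n)).
  apply/funext => n.
  by rewrite {1}(lposB f).
rewrite -[0](subr0 0); apply: cvgB; apply: h; exact: lpos_ge0.
Qed.

(* The restriction of phi to the band generated by D. *)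
Lemma component_functional (phi : dual E) (D : set E) :
    0 <= phi -> D 0 -> (forall d, D d -> 0 <= d) ->
    (forall d e, D d -> D e -> D (d + e)) ->
    (forall a d, 0 <= a -> D d -> D (a *: d)) ->
  exists psi : dual E, [/\ 0 <= psi,
    forall f d, 0 <= f -> D d -> phi (f `&` d) <= psi f &
    forall f c, 0 <= f -> (forall d, D d -> phi (f `&` d) <= c) -> psi f <= c].
Proof.
move=> phi0 D0 Dge0 DD DZ.
pose p f := sup [set phi (f `&` d) | d in D].
have hs f : has_sup [set phi (f `&` d) | d in D].
  split; first by exists (phi (f `&` 0)), 0.
  by exists (phi f) => _ [d _ <-]; apply: dual_homo; rewrite ?leIl.
have ub f d : D d -> phi (f `&` d) <= p f.
  by move=> Dd; apply: (sup_upper_bound (hs f)); exists d.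
have lu f c : (forall d, D d -> phi (f `&` d) <= c) -> p f <= c.
  by move=> h; apply: ge_sup; [case: (hs f)|move=> _ [d /h ? <-]].
have p0 f : 0 <= f -> 0 <= p f.
  move=> f0; rewrite (le_trans _ (ub _ _ D0))//.
  by rewrite dual_ge0// lexI f0/=.
(* Subadditivity comes from [meetDl_le]. For superadditivity, the meets of [f] with [d] and of [g]
   with [e] add up to at most the meet of [f + g] with [d + e], and [D] is closed under sums. *)
have pD f g : 0 <= f -> 0 <= g -> p (f + g) = p f + p g.
  move=> f0 g0; apply/eqP; rewrite eq_le; apply/andP; split.
    apply: lu => d Dd; apply: (@le_trans _ _ (phi (f `&` d + g `&` d))).
      by apply: dual_homo => //; apply: meetDl_le => //; exact: Dge0.
    by rewrite linearD lerD ?ub.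
  rewrite -lerBrDr; apply: (lu) => d Dd; rewrite lerBrDr -lerBrDl; apply: lu.
  move=> e De; rewrite lerBrDl -linearD; apply: le_trans (ub _ _ (DD _ _ Dd De)).
  apply: dual_homo => //; rewrite lexI.
  by rewrite !lat_leD// ?leIl ?leIr.
have pZle b f : 0 < b -> 0 <= f -> b * p f <= p (b *: f).
  move=> b0 f0; rewrite mulrC -ler_pdivlMr//; apply: lu => d Dd.
  rewrite ler_pdivlMr// mulrC; apply: (@le_trans _ _ (phi (b *: (f `&` d)))).
    by rewrite linearZ.
  apply: le_trans (ub _ _ (DZ b d (ltW b0) Dd)); apply: dual_homo => //.
  by rewrite lexI !lat_leZ ?(ltW b0) ?leIl ?leIr.
have pZ a f : 0 <= a -> 0 <= f -> p (a *: f) = a * p f.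
  rewrite le_eqVlt => /orP[/eqP <- f0|a0 f0].
    have := pD 0 0 (lexx _) (lexx _); rewrite addr0 scale0r mul0r; lra.
  apply/eqP; rewrite eq_le pZle// andbT -ler_pdivrMl//.
  have ai : 0 < a^-1 by rewrite invr_gt0.
  rewrite (le_trans (pZle _ _ ai _)) ?(lat_scale_ge0 (ltW a0))//.
  by rewrite scalerA mulVf ?gt_eqF// scale1r.
have [|psi psiE] := @cone_extension _ _ p `|phi| pD pZ.
  move=> f f0; rewrite ger0_norm ?p0//; apply: lu => d Dd.
  rewrite (le_trans (ler_norm _))// (le_trans (ler_dual _ _))// ler_wpM2l//.
  have fd0 : 0 <= f `&` d by rewrite lexI f0 Dge0.
  by apply: le_norm; rewrite !ge0_labs// leIl.
exists psi; split.
- by apply/le_dualP => f f0; rewrite psiE// p0.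
- by move=> f d f0 Dd; rewrite psiE// ub.
- by move=> f c f0 h; rewrite psiE// lu.
Qed.

(** Take for [psi n] the restriction of [phi] to the band of [g n], computed with the nonnegative
    multiples of [g n]. These bands are pairwise disjoint, so together they carry no more than
    [phi]. *)
Lemma disjoint_components (phi : dual E) (g : nat -> E) : 0 <= phi ->
    (forall n, 0 <= g n) -> (forall n k, n != k -> g n `&` g k = 0) ->
  exists psi : nat -> dual E, [/\ forall n, 0 <= psi n,
    forall n, phi (g n) <= psi n (g n) &
    forall N, \sum_(n < N) psi n <= phi].
Proof.
move=> phi0 g0 gd.
have /choice[psi psiP] n : exists psi : dual E, [/\ 0 <= psi,
    phi (g n) <= psi (g n) & forall f c, 0 <= f ->
    (forall a, 0 <= a -> phi (f `&` (a *: g n)) <= c) -> psi f <= c].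
  have [|||||psi [psi0 h1 h2]] :=
    @component_functional phi [set a *: g n | a in [set a : R | 0 <= a]] => //.
  - by exists 0 => //=; rewrite scale0r.
  - by move=> _ [a /= a0 <-]; rewrite lat_scale_ge0.
  - move=> _ _ [a /= a0 <-] [b /= b0 <-]; exists (a + b); first exact: addr_ge0.
    by rewrite scalerDl.
  - move=> b _ b0 [a /= a0 <-]; exists (b * a); first exact: mulr_ge0.
    by rewrite scalerA.
  exists psi; split=> //.
    rewrite -{1}(meetxx (g n)); apply: h1 => //; exists 1 => //=.
    by rewrite scale1r.
  by move=> f c f0 h; apply: h2 => // _ [a /= a0 <-]; exact: h.
exists psi; split; [by move=> n; case: (psiP n)|by move=> n; case: (psiP n)|].
(* The extra vector [e], disjoint from the first [N] vectors [g n], makes the induction work: it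
   absorbs the multiple [a *: g N] that occurs in the supremum defining [psi N]. The case [e = 0] is
   the claim. *)
have key N : forall f e, 0 <= f -> 0 <= e ->
    (forall n, (n < N)%N -> e `&` g n = 0) ->
    (\sum_(n < N) psi n) f + phi (f `&` e) <= phi f.
  elim: N => [|N IH] f e f0 e0 eg.
    by rewrite big_ord0 dual_zeroE add0r dual_homo// leIl.
  rewrite big_ord_recr dual_addE addrAC -lerBrDl.
  have [_ _ psile] := psiP N; apply: psile => // a a0.
  have ag0 : 0 <= a *: g N by rewrite lat_scale_ge0.
  have de : (a *: g N) `&` e = 0 by apply: meet0Z => //; rewrite meetC eg.
  have le : f `&` e + f `&` (a *: g N) <= f `&` (a *: g N + e).
    rewrite lexI [a *: _ + e]addrC lat_leD ?leIr// andbT.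
    rewrite leD_disjoint ?leIl//.
    by apply: (meet0_le _ _ (leIr _ _) (leIr _ _)) (etrans (meetC _ _) de);
      rewrite lexI f0.
  rewrite lerBrDl -addrA; apply: le_trans (IH f (a *: g N + e) f0 _ _).
  - rewrite lerD2l -linearD; apply: dual_homo => //; exact: le.
  - exact: lat_addr_ge0.
  - move=> n nN; apply: meet0D => //; last by rewrite eg// ltnW.
    by apply: meet0Z => //; apply: gd; rewrite gtn_eqF.
move=> N; apply/le_dualP => f f0; have := key N f 0 f0 (lexx _).
rewrite (_ : f `&` 0 = 0) ?linear0 ?addr0; last exact/meet_idPr.
by apply => n _; exact/meet_idPl.
Qed.

(* With psi the restriction of phi to the band disjoint from all the negative
   parts, phi (labs (x n)) is at most 2 psi (x n) - phi (x n). *)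
Lemma disjoint_labs_weakly_null (x : nat -> E) :
  disjoint_seq x -> weakly_null x -> weakly_null (fun n => labs (x n)).
Proof.
move=> xd xw; apply: ge0_weakly_null => phi phi0.
have xnk n k : lpos (x n) `&` lpos (- x k) = 0.
  have [->|nk] := eqVneq n k; first exact: meet_lposN.
  apply: meet0_le (xd _ _ nk); rewrite ?lpos_ge0 ?lpos_le_labs//.
  by rewrite -labsN lpos_le_labs.
pose D : set E := [set d : E | 0 <= d /\ forall n, d `&` lpos (- x n) = 0].
have [||||psi [psi0 h1 h2]] := @component_functional phi D phi0.
- by split=> // n; apply/meet_idPl; exact: lpos_ge0.
- by move=> d [].
- move=> d e [d0 dx] [e0 ex]; split; first exact: lat_addr_ge0.
  by move=> n; apply: meet0D; rewrite ?lpos_ge0.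
- move=> a d a0 [d0 dx]; split; first exact: lat_scale_ge0.
  by move=> n; apply: meet0Z; rewrite ?lpos_ge0.
(* [psi] dominates [phi] at [lpos (x n)], which belongs to [D], and is at most 0 at [lpos (- x n)],
   which is disjoint from all of [D]. *)
have pos n : phi (lpos (x n)) <= psi (x n).
  rewrite [in leRHS](lposB (x n)) linearB/=.
  have := h1 (lpos (x n)) (lpos (x n)) (lpos_ge0 _); rewrite meetxx => h.
  have {}h : phi (lpos (x n)) <= psi (lpos (x n)).
    by apply: h; split; rewrite ?lpos_ge0.
  have := h2 (lpos (- x n)) 0 (lpos_ge0 _) => h'.
  have {}h' : psi (lpos (- x n)) <= 0.
    by apply: h' => d [d0 dx]; rewrite meetC dx linear0.
  lra.
apply: (@le_cvg0 _ _ (fun n => psi (x n) + (psi (x n) - phi (x n)))) => [n|].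
  rewrite ger0_norm; last by rewrite dual_ge0// labs_ge0.
  have := pos n; rewrite -lposD linearD.
  have : phi (x n) = phi (lpos (x n)) - phi (lpos (- x n)).
    by rewrite {1}(lposB (x n)) linearB.
  lra.
rewrite -[0](addr0 0); apply: cvgD; first exact: xw.
rewrite -[0](subr0 0); apply: cvgB; exact: xw.
Qed.

End Riesz.

(** * Order bounds, uniform boundedness and disjointification in Banach lattices *)

Section BanachLatticeAnalysis.
Variables (R : realType) (E : banachLatticeType R).
Implicit Types (x y z : E).
Local Notation "x `|` y" := (Order.join x y).
Local Notation "x `&` y" := (Order.meet x y).

(** If [v n >= 0] then [- l <= v n - l], so the negative part of [l] has norm at most that of
    [l - v n]. *)
Lemma cvg_lat_ge0 (v : nat -> E) (l : E) :
  v @ \oo --> l -> (\forall n \near \oo, 0 <= v n) -> 0 <= l.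
Proof.
move=> vl v0; suff h : lpos (- l) = 0.
  by rewrite (lposB l) h subr0 lpos_ge0.
apply/eqP; rewrite -normr_le0; apply/ler_addgt0Pr => e e0; rewrite add0r.
have /cvgrPdist_le/(_ e e0) h := vl.
near \oo => n; apply: (@le_trans _ _ `|l - v n|); last by near: n.
apply: le_norm; rewrite ge0_labs ?lpos_ge0// leUx labs_ge0 andbT.
apply: (le_trans _ (leN_labs _)); rewrite opprB -[leLHS]add0r lat_leD2r.
by near: n.
Unshelve. all: by end_near. Qed.

(** The series of these vectors converges absolutely, and its sum dominates every term because the
    cone is closed. *)
Lemma geometric_upper_bound (x : nat -> E) (C : R) :
    (forall n, 0 <= x n) -> (forall n, `|x n| <= C) ->
  exists s, forall n, 2^-1 ^+ n *: x n <= s.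
Proof.
move=> x0 xC; pose u : nat -> E := fun n => 2^-1 ^+ n *: x n.
have u0 n : 0 <= u n by rewrite lat_scale_ge0// exprn_ge0// invr_ge0.
have C0 : 0 <= C by apply: le_trans (xC 0).
have : cvgn (series u).
  apply: normed_cvg; apply: (@series_le_cvg _ _ (geometric C 2^-1)).
  - by move=> n; exact: normr_ge0.
  - by move=> n; rewrite /= mulr_ge0// exprn_ge0// invr_ge0.
  - move=> n; rewrite /= normrZ ger0_norm ?exprn_ge0 ?invr_ge0// mulrC.
    by rewrite ler_wpM2r// exprn_ge0 ?invr_ge0.
  - apply: is_cvg_geometric_series; rewrite ger0_norm ?invr_ge0//.
    by rewrite invf_lt1// ltr1n.
move=> us; exists (limn (series u)) => n.
rewrite -lat_subr_ge0; apply: (@cvg_lat_ge0 (fun N => series u N - u n)).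
  by apply: cvgB; [exact: us|exact: cvg_cst].
near=> N; rewrite lat_subr_ge0 /series/=.
have nN : (n < N)%N by near: N; exact: nbhs_infty_gt.
rewrite big_mkord (bigD1 (Ordinal nN))//= -[leLHS]addr0.
apply: lat_leD => //; elim/big_rec: _ => // i y _ y0.
exact: lat_addr_ge0.
Unshelve. all: by end_near. Qed.

(** A uniform boundedness principle in which continuity is a conclusion. Otherwise there are
    positive [x n] in the unit ball and indices [t n] with [F (t n) (x n) >= 4 ^+ n]. A common upper
    bound [s] of the vectors [2^-1 ^+ n *: x n] then gives [F (t n) s >= 2 ^+ n], against the bound
    at [s]. *)
Lemma positive_functionals_bounded (T : Type) (F : T -> E -> R) :
    (forall t, linear (F t : E -> R^o)) ->
    (forall t x, 0 <= x -> 0 <= F t x) ->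
    (forall x, 0 <= x -> exists M, forall t, F t x <= M) ->
  exists2 C, 0 <= C & forall t x, `|F t x| <= C * `|x|.
Proof.
move=> Fl F0 Fb.
pose L t : {linear E -> R^o} :=
  HB.pack (F t : E -> R^o) (GRing.isLinear.Build R E R^o _ _ (Fl t)).
have LE t x : F t x = L t x by [].
have homo t x y : x <= y -> F t x <= F t y.
  by move=> xy; rewrite -subr_ge0 !LE -linearB; apply: F0; rewrite lat_subr_ge0.
apply: contrapT => nb.
have /choice[tx txP] n : exists p : T * E, [/\ 0 <= p.2, `|p.2| <= 1 &
    4 ^+ n <= F p.1 p.2].
  apply: contrapT => no; apply: nb; exists (4 ^+ n); first exact: exprn_ge0.
  move=> t x; rewrite leNgt; apply/negP => lt.
  have xn0 : 0 < `|x|.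
    rewrite normr_gt0; apply: contraTneq lt => ->.
    by rewrite !LE linear0 !normr0 mulr0 ltxx.
  apply: no; exists (t, `|x|^-1 *: labs x); split=> /=.
  - by rewrite lat_scale_ge0 ?labs_ge0 ?invr_ge0.
  - by rewrite normrZ norm_labs normfV normr_id mulVf ?gt_eqF.
  - rewrite LE linearZ /= ler_pdivlMl// mulrC.
    apply: le_trans (ltW lt) _; rewrite ler_norml; apply/andP; split.
      rewrite lerNl LE -linearN -LE; apply: homo; exact: leN_labs.
    apply: homo; exact: le_labs.
have [||s sP] := @geometric_upper_bound (fun n => (tx n).2) 1.
- by move=> n; case: (txP n).
- by move=> n; case: (txP n).
have s0 : 0 <= s.
  by apply: le_trans (sP 0); rewrite expr0 scale1r; case: (txP 0).
have [M MP] := Fb s s0.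
have bnd n : n%:R <= M.
  apply: le_trans (MP (tx n).1); apply: le_trans (homo _ _ _ (sP n)).
  rewrite LE linearZ /=; have [_ _ h] := txP n.
  apply: (@le_trans _ _ (2^-1 ^+ n * 4 ^+ n)); last first.
    by rewrite ler_wpM2l// exprn_ge0// invr_ge0.
  have -> : (2^-1 ^+ n * 4 ^+ n : R) = 2 ^+ n.
    by rewrite -exprMn; congr (_ ^+ n); lra.
  by rewrite -natrX ler_nat ltnW// ltn_expl.
have M0 : 0 <= M := bnd 0.
have := bnd (Num.bound M); rewrite leNgt archi_boundP//.
Qed.

Lemma weak_star_null_bounded (u : nat -> dual E) :
    (forall n, 0 <= u n) -> weak_star_null u ->
  exists2 C, 0 < C & forall n, `|u n| <= C.
Proof.
move=> u0 uw.
have [|||C C0 CP] := @positive_functionals_bounded _ (fun n x => u n x).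
- by move=> n; exact: dual_linear.
- by move=> n x x0; exact: dual_ge0.
- move=> x x0; have /cvg_seq_bounded[M [_ /(_ (M + 1))]] : cvgn (fun n => u n x).
    by apply/cvg_ex; exists 0; exact: uw.
  rewrite ltrDl ltr01 => /(_ isT) h1; exists (M + 1) => n.
  by rewrite (le_trans (ler_norm _))// h1.
exists (C + 1) => [|n]; first by rewrite ltr_wpDl.
by apply: (@le_trans _ _ C); [exact: dual_norm_le|rewrite lerDl].
Qed.

End BanachLatticeAnalysis.

(* Along a subsequence h, the vectors
     g n = (h n - c n * (h 0 + .. + h (n - 1)) - 2 ^ - n * s)^+
   are disjoint and u n is tiny on what has been subtracted, hence u n (h n) is
   controlled by `|g n|. *)
Lemma weak_star_null_uniform (R : realType) (G : banachLatticeType R)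
    (w : nat -> R) (f : nat -> G) (u : nat -> dual G) :
    (forall n, 0 < w n) -> (forall n, 0 <= f n) ->
    (forall sigma : nat -> nat, exists s, forall n, w n *: f (sigma n) <= s) ->
    (forall (sigma : nat -> nat) (g : nat -> G),
      (forall n, 0 <= g n <= f (sigma n)) ->
      (forall n k, n != k -> Order.meet (g n) (g k) = 0) ->
      g @ \oo --> (0 : G)) ->
    (forall n, 0 <= u n) -> weak_star_null u ->
  (fun n => u n (f n)) @ \oo --> (0 : R).
Proof.
move=> w0 f0 fs fg u0 uw; apply: contrapT => nc.
have [e e0 eP] : exists2 e : R, 0 < e &
    forall N, exists2 k, (N <= k)%N & e <= u k (f k).
  apply: contrapT => no; apply: nc; apply/cvgr0Pnorm_lt => e e0.
  apply: contrapT => h; apply: no; exists e => // N.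
  apply: contrapT => h'; apply: h; exists N => // k /= Nk.
  rewrite ger0_norm ?(dual_ge0 (u0 k))// ltNge; apply/negP => le.
  by apply: h'; exists k.
(* This size gives [(a n * w k)^-1 <= c k] for [n < k], with [a n] the power [2^-1 ^+ n];
   disjointness of the vectors [g n] rests on it. *)
pose c n : R := 2 ^+ n / w n.
have c0 n : 0 <= c n by rewrite divr_ge0 ?exprn_ge0 ?(ltW (w0 _)).
(* Weak-star convergence at the fixed vector [c p.1 *: p.2] makes [u k] small there for large [k],
   and some such [k] has [u k (f k) >= e]. The second component of [p] will be the sum [S n] of the
   vectors chosen before. *)
have /choice[pick pickP] (p : nat * G) : exists k,
    e <= u k (f k) /\ u k (c p.1 *: p.2) <= 2^-1 ^+ p.1.
  have /cvgr0Pnorm_lt/(_ (2^-1 ^+ p.1)) h := uw (c p.1 *: p.2).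
  have [|N _ NP] := h; first by rewrite exprn_gt0// invr_gt0.
  have [k Nk ek] := eP N; exists k; split=> //.
  by rewrite (le_trans (ler_norm _))// ltW// NP.
pose S := fix S n : G := if n is n'.+1 then S n' + f (pick (n', S n')) else 0.
pose sigma n := pick (n, S n).
pose h n := f (sigma n).
have h0 n : 0 <= h n by exact: f0.
have Sge0 n : 0 <= S n.
  by elim: n => [|n IH] //=; rewrite lat_addr_ge0.
have hS n k : (n < k)%N -> h n <= S k.
  elim: k => // k IH; rewrite ltnS leq_eqVlt => /orP[/eqP ->|nk] /=.
    by rewrite -[leLHS]add0r lat_leD2r.
  by rewrite -[leLHS]addr0 lat_leD// IH.
have [s sP] := fs sigma.
have s0 : 0 <= s by apply: le_trans (sP 0); rewrite lat_scale_ge0 ?(ltW (w0 _)).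
pose a n : R := 2^-1 ^+ n.
have a0 n : 0 < a n by rewrite exprn_gt0// invr_gt0.
pose g n := lpos (h n - c n *: S n - a n *: s).
have scS n : 0 <= c n *: S n by rewrite lat_scale_ge0.
have as0 n : 0 <= a n *: s by rewrite lat_scale_ge0// ltW.
have gf n : 0 <= g n <= h n.
  rewrite lpos_ge0 leUx h0 andbT !lat_leBlDr -addrA -[leLHS]addr0.
  by rewrite lat_leD// lat_addr_ge0.
have gd n k : (n < k)%N -> Order.meet (g n) (g k) = 0.
  (* With [p = h n - b *: h k], the vector [g n] lies below the positive part of [p] since
     [w k *: h k <= s], and [b *: g k] lies below its negative part since
     [b^-1 *: h n <= c k *: S k]. *)
  move=> nk; pose b := a n * w k.
  have b0 : 0 < b by rewrite mulr_gt0.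
  pose p := h n - b *: h k.
  apply: (@meet0_le _ _ (lpos p) (b^-1 *: lpos (- p))); rewrite ?lpos_ge0//.
  - apply: lpos_le; rewrite -addrA lat_leD// -opprD lat_leN2.
    rewrite -[leLHS]add0r lat_leD// /b -scalerA.
    by apply: lat_leZ; rewrite // ltW.
  - rewrite -lposZ ?invr_ge0 ?(ltW b0)//; apply: lpos_le.
    rewrite opprB scalerBr scalerA mulVf ?gt_eqF// scale1r -addrA lat_leD//.
    rewrite -opprD lat_leN2 -[leLHS]addr0 lat_leD//.
    apply: (@le_trans _ _ (b^-1 *: S k)).
      by apply: lat_leZ; rewrite ?invr_ge0 ?(ltW b0)// hS.
    rewrite -lat_subr_ge0 -scalerBl lat_scale_ge0// subr_ge0.
    rewrite /b /c invfM mulrC [leRHS]mulrC ler_wpM2l ?invr_ge0 ?(ltW (w0 _))//.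
    rewrite /a exprVn invrK; apply: ler_weXn2l; last exact: ltnW.
    by rewrite ler1n.
  - rewrite meetC; apply: meet0Z; rewrite ?lpos_ge0 ?invr_ge0 ?(ltW b0)//.
    by rewrite meetC meet_lposN.
have gcv : g @ \oo --> (0 : G).
  apply: (fg sigma) => // n k; rewrite neq_ltn => /orP[nk|kn]; first exact: gd.
  by rewrite meetC gd.
have [C _ CP] := weak_star_null_bounded u0 uw.
have ubound n : e <= C * `|g n| + a n + a n * (C * `|s|).
  have [e1 c1] := pickP (n, S n); apply: (le_trans e1); rewrite -/(sigma n) /=.
  apply: (@le_trans _ _ (u (sigma n) (g n + c n *: S n + a n *: s))).
    apply: dual_homo => //; rewrite -!lat_leBlDr.
    by rewrite addrAC leUl.
  rewrite !linearD/= lerD//.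
    rewrite lerD//.
    by rewrite (le_trans (ler_norm _))// (le_trans (ler_dual _ _))// ler_wpM2r.
  rewrite linearZ /= ler_wpM2l ?(ltW (a0 _))//.
  by rewrite (le_trans (ler_norm _))// (le_trans (ler_dual _ _))// ler_wpM2r.
have : (fun n => C * `|g n| + a n + a n * (C * `|s|)) @ \oo --> (0 : R).
  have acv : a @ \oo --> (0 : R).
    by apply: cvg_expr; rewrite ger0_norm ?invr_ge0// invf_lt1// ltr1n.
  rewrite [X in _ --> X](_ : _ = C * 0 + 0 + 0 * (C * `|s|)); last by lra.
  apply: cvgD; [apply: cvgD => //|].
    by apply: cvgM; [exact: cvg_cst|rewrite -(normr0 G); exact: cvg_norm].
  by apply: cvgM => //; exact: cvg_cst.
move=> /cvgr0Pnorm_lt/(_ e e0)[N _ /(_ N (leqnn N))].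
by rewrite /= ltNge (le_trans (ubound N)) ?ler_norm.
Qed.

(** * Positive and regular multilinear forms *)

Section Forms.
Variables (R : realType) (m : nat) (E : 'I_m -> banachLatticeType R).
Implicit Types (x y : forall i, E i) (B C : (forall i, E i) -> R).

Definition positive_multilinear B : Prop := multilinear B /\ positive_form B.

Lemma dfwith_id x i : dfwith x i (x i) = x.
Proof.
apply: functional_extensionality_dep => j.
by case: dfwithP.
Qed.

Lemma multilinearD B : multilinear B -> forall i x s t,
  B (dfwith x i (s + t)) = B (dfwith x i s) + B (dfwith x i t).
Proof. by move=> Bl i x s t; have := Bl i x 1 s t; rewrite !scale1r. Qed.

Lemma multilinear0 B : multilinear B -> forall i x, B (dfwith x i 0) = 0.
Proof.
move=> Bl i x; have := multilinearD Bl x (0 : E i) 0; rewrite addr0; lra.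
Qed.

Lemma multilinearZ B : multilinear B -> forall i x a s,
  B (dfwith x i (a *: s)) = a * B (dfwith x i s).
Proof.
by move=> Bl i x a s; have := Bl i x a s 0; rewrite addr0 multilinear0// addr0.
Qed.

Lemma multilinearB B : multilinear B -> forall i x s t,
  B (dfwith x i (s - t)) = B (dfwith x i s) - B (dfwith x i t).
Proof.
move=> Bl i x s t; rewrite multilinearD// -scaleN1r multilinearZ//; lra.
Qed.

Lemma multilinear_scale B (a : R) x : multilinear B ->
  B (fun i => a *: x i) = a ^+ m * B x.
Proof.
move=> Bl.
(* The list [s] holds the coordinates that have been scaled; it grows to all of them. *)
have key s : uniq s -> B (fun i => if i \in s then a *: x i else x i) =
    a ^+ size s * B x.
  elim: s => [|i s IH] /=; first by rewrite mul1r.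
  case/andP=> is_ us; rewrite exprS -mulrA -IH//.
  set y := (fun j => if j \in s then _ else _).
  have yi : y i = x i by rewrite /y (negbTE is_).
  rewrite -[in RHS](dfwith_id y i) yi -multilinearZ//; congr (B _).
  apply: functional_extensionality_dep => j; rewrite in_cons.
  case: dfwithP => [|k ik]; first by rewrite eqxx.
  by rewrite eq_sym (negbTE ik).
have := key _ (enum_uniq 'I_m); rewrite size_enum_ord => <-; congr (B _).
by apply: functional_extensionality_dep => j; rewrite mem_enum.
Qed.

Lemma positive_form_le B x y : positive_multilinear B ->
  (forall i, 0 <= x i) -> (forall i, x i <= y i) -> B x <= B y.
Proof.
move=> [Bl B0] x0 xy.
(* The list [s] holds the coordinates where [z] may still differ from [y]; they are raised to [y]
   one at a time. *)
have key (s : seq 'I_m) z : (forall i, 0 <= z i <= y i) ->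
    (forall i, i \notin s -> z i = y i) -> B z <= B y.
  elim: s z => [|i s IH] z zy zs.
    suff -> : z = y by [].
    by apply: functional_extensionality_dep => i; exact: zs.
  apply: (@le_trans _ _ (B (dfwith z i (y i)))).
    rewrite -{1}(dfwith_id z i) -subr_ge0 -multilinearB//; apply: B0 => j.
    case: dfwithP => [|k ik]; last by case/andP: (zy k).
    by rewrite lat_subr_ge0; case/andP: (zy i).
  apply: IH => j; case: dfwithP => //.
    by case/andP: (zy i) => z0 zi; rewrite lexx (le_trans z0 zi).
  by move=> k ik ks; apply: zs; rewrite in_cons negb_or ks andbT eq_sym.
by apply: (key (enum 'I_m)) => i; rewrite ?x0 ?xy// mem_enum.
Qed.

Lemma norm_positive_form B x : positive_multilinear B ->
  `|B x| <= B (fun i => labs (x i)).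
Proof.
move=> [Bl B0].
(* Coordinates in [s] may still have any sign. Each step splits one into positive and negative
   parts, whose sum is the modulus. *)
have key (s : seq 'I_m) z : (forall i, i \notin s -> 0 <= z i) ->
    `|B z| <= B (fun i => labs (z i)).
  elim: s z => [|i s IH] z zs.
    rewrite ger0_norm; last by apply: B0 => i; exact: zs.
    suff -> : (fun i => labs (z i)) = z by [].
    by apply: functional_extensionality_dep => i; rewrite ge0_labs// zs.
  have labsE t : 0 <= t -> (fun j => labs (dfwith z i t j)) =
      dfwith (fun j => labs (z j)) i t.
    move=> t0; apply: functional_extensionality_dep => j.
    case: dfwithP => [|k ik]; first by rewrite dfwithin ge0_labs.
    by rewrite dfwithout.
  have ns t : 0 <= t -> forall j, j \notin s -> 0 <= dfwith z i t j.
    move=> t0 j; case: dfwithP => // k ik ks; apply: zs.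
    by rewrite in_cons negb_or ks andbT eq_sym.
  rewrite -{1}(dfwith_id z i) {1}(lposB (z i)) multilinearB//.
  rewrite (le_trans (ler_normB _ _))//.
  rewrite -(dfwith_id (fun j => labs (z j)) i) -lposD multilinearD//.
  have p0 := lpos_ge0 (z i); have n0 := lpos_ge0 (- z i).
  by rewrite -!labsE// lerD// IH//; apply: ns.
by apply: (key (enum 'I_m)) => i; rewrite mem_enum.
Qed.

Lemma positive_multilinearD (a : R) B C : 0 <= a ->
  positive_multilinear B -> positive_multilinear C ->
  positive_multilinear (fun x => a * B x + C x).
Proof.
move=> a0 [Bl B0] [Cl C0]; split=> [i x b s t|x x0].
  by rewrite /= Bl Cl /GRing.scale /=; lra.
by rewrite addr_ge0 ?mulr_ge0 ?B0 ?C0.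
Qed.

Lemma regular_formD (a : R) B C :
  regular_form B -> regular_form C -> regular_form (fun x => a * B x + C x).
Proof.
move=> [B1 [B2 [pB1 pB2 ->]]] [C1 [C2 [pC1 pC2 ->]]].
have [a0|a0] := leP 0 a.
  exists (fun x => a * B1 x + C1 x), (fun x => a * B2 x + C2 x); split.
  - exact: positive_multilinearD.
  - exact: positive_multilinearD.
  - by apply/funext => x /=; lra.
(* A negative factor exchanges the two positive components of [B]. *)
have Na0 : 0 <= - a by rewrite oppr_ge0 ltW.
exists (fun x => - a * B2 x + C1 x), (fun x => - a * B1 x + C2 x); split.
- exact: positive_multilinearD.
- exact: positive_multilinearD.
- by apply/funext => x /=; lra.
Qed.

Lemma positive_regular B : positive_multilinear B -> regular_form B.
Proof.
move=> pB; exists B, (fun=> 0); split=> //.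
  split=> [i x a s t|x _]; last exact: lexx.
  by rewrite /= scaler0 addr0.
by apply/funext => x /=; rewrite subr0.
Qed.

Lemma regular_multilinear B : regular_form B -> multilinear B.
Proof.
move=> [B1 [B2 [[l1 _] [l2 _] ->]]] i x a s t /=.
by rewrite l1 l2 /GRing.scale /=; lra.
Qed.

End Forms.

(** * Separating the last variable of a form *)

Section Snoc.
Variables (R : realType) (m : nat) (E : 'I_m.+1 -> banachLatticeType R).
Implicit Types (x : forall i, E i) (y : forall j : 'I_m, E (lift ord_max j)).

Lemma ord_max_ind (P : 'I_m.+1 -> Prop) :
  P ord_max -> (forall j : 'I_m, P (lift ord_max j)) -> forall i, P i.
Proof. by move=> Pm Pl i; case: (unliftP ord_max i) => [j ->|->]. Qed.

Lemma tuple_snoc_ext x x' : x ord_max = x' ord_max ->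
  (forall j : 'I_m, x (lift ord_max j) = x' (lift ord_max j)) -> x = x'.
Proof.
by move=> h1 h2; apply: functional_extensionality_dep; exact: ord_max_ind.
Qed.

Lemma tuple_snoc_eta x : tuple_snoc (fun j => x (lift ord_max j)) (x ord_max) = x.
Proof.
by apply: tuple_snoc_ext => [|j]; rewrite ?tuple_snoc_max ?tuple_snoc_lift.
Qed.

Lemma dfwith_lift x j (t : E (lift ord_max j)) k :
  dfwith x (lift ord_max j) t (lift ord_max k) =
  dfwith (fun l : 'I_m => x (lift ord_max l)) j t k.
Proof.
have [jk|jk] := eqVneq j k; first by subst k; rewrite !dfwithin.
by rewrite !dfwithout// (inj_eq lift_inj).
Qed.

Lemma tuple_snoc_dfwith y j t s :
  tuple_snoc (dfwith y j t) s = dfwith (tuple_snoc y s) (lift ord_max j) t.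
Proof.
apply: tuple_snoc_ext => [|k].
  by rewrite dfwithout ?tuple_snoc_max// eq_sym neq_lift.
rewrite dfwith_lift tuple_snoc_lift; suff -> :
  (fun l : 'I_m => tuple_snoc y s (lift ord_max l)) = y by [].
by apply: functional_extensionality_dep => l; rewrite tuple_snoc_lift.
Qed.

Lemma dfwith_tuple_snoc y s t :
  dfwith (tuple_snoc y s) ord_max t = tuple_snoc y t.
Proof.
apply: tuple_snoc_ext => [|k]; first by rewrite dfwithin tuple_snoc_max.
by rewrite dfwithout ?tuple_snoc_lift// neq_lift.
Qed.

Lemma tuple_snoc_ge0 y t : (forall j, 0 <= y j) -> 0 <= t ->
  forall i, 0 <= tuple_snoc y t i.
Proof.
move=> y0 t0; apply: ord_max_ind => [|j]; first by rewrite tuple_snoc_max.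
by rewrite tuple_snoc_lift.
Qed.

Definition slice (B : (forall i, E i) -> R) y : dual (E ord_max) :=
  to_dual (fun t => B (tuple_snoc y t)).

Lemma thetaE B u y : theta u B y = u (slice B y).
Proof. by []. Qed.

(** The junk value of [to_dual] does not occur here: a regular form is continuous in its last
    variable, by automatic boundedness of positive functionals. *)
Lemma sliceE B y t : regular_form B -> slice B y t = B (tuple_snoc y t).
Proof.
move=> rB; have Bl := regular_multilinear rB.
have Bly : linear ((fun t => B (tuple_snoc y t)) : _ -> R^o).
  by move=> a s r; have := Bl ord_max (tuple_snoc y 0) a s r;
    rewrite !dfwith_tuple_snoc.
suff [g gE] : exists g : dual (E ord_max), forall t, g t = B (tuple_snoc y t).
  rewrite /slice (_ : (fun _ => _) = g); last by apply/funext => r; rewrite gE.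
  by rewrite to_dualE ?gE//; [exact: dual_linear|exact: dual_continuous].
apply: bounded_dual.
- by move=> s r; have := Bly 1 s r; rewrite !scale1r.
- move=> a s; have := Bly a s 0; rewrite addr0.
  by rewrite -(dfwith_tuple_snoc y 0 0) multilinear0// addr0.
- move: rB => [B1 [B2 [p1 p2 BE]]].
  (* Both positive components form one family, so a single constant bounds them. Freezing the other
     variables at their moduli makes these functionals positive. *)
  pose F (b : bool) t :=
    (if b then B1 else B2) (tuple_snoc (fun j => labs (y j)) t).
  have y0 j : 0 <= labs (y j) by exact: labs_ge0.
  have [|||C _ CP] := @positive_functionals_bounded _ _ _ F.
  + move=> b a s r; have [l _] : positive_multilinear (if b then B1 else B2).
      by case: b.
    by have := l ord_max (tuple_snoc (fun j => labs (y j)) 0) a s r;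
      rewrite !dfwith_tuple_snoc.
  + move=> b t' t0; have [_ p] : positive_multilinear (if b then B1 else B2).
      by case: b.
    by apply: p; exact: tuple_snoc_ge0.
  + move=> t' t0; exists (Num.max (F true t') (F false t')) => b.
    by rewrite le_max; case: b; rewrite lexx ?orbT.
  have labsE t' : (fun i => labs (tuple_snoc y t' i)) =
      tuple_snoc (fun j => labs (y j)) (labs t').
    by apply: tuple_snoc_ext => [|j]; rewrite ?tuple_snoc_max ?tuple_snoc_lift.
  exists (C + C) => t'; rewrite BE /= (le_trans (ler_normB _ _))// mulrDl.
  rewrite lerD//.
    rewrite (le_trans (norm_positive_form _ p1))// labsE.
    rewrite (le_trans (ler_norm _))// (le_trans (CP true _))//.
    by rewrite norm_labs.
  rewrite (le_trans (norm_positive_form _ p2))// labsE.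
  rewrite (le_trans (ler_norm _))// (le_trans (CP false _))//.
  by rewrite norm_labs.
Qed.

Lemma slice_ge0 B y : positive_multilinear B -> (forall j, 0 <= y j) ->
  0 <= slice B y.
Proof.
move=> pB y0; apply/le_dualP => t t0; rewrite dual_zeroE sliceE.
  by apply: (pB.2); exact: tuple_snoc_ge0.
exact: positive_regular.
Qed.

Lemma slice_linear B y j a s t : regular_form B ->
  slice B (dfwith y j (a *: s + t)) =
  a *: slice B (dfwith y j s) + slice B (dfwith y j t).
Proof.
move=> rB; apply: dualP => r; rewrite dual_addE dual_scaleE !sliceE//.
rewrite !tuple_snoc_dfwith; exact: regular_multilinear.
Qed.

Lemma theta_positive B (u : bidual (E ord_max)) : 0 <= u ->
  positive_multilinear B -> positive_multilinear (theta u B).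
Proof.
move=> u0 pB; split=> [j y a s t|y y0].
  rewrite !thetaE slice_linear; last exact: positive_regular.
  by rewrite linearD linearZ.
by apply: dual_ge0 => //; exact: slice_ge0.
Qed.

Lemma theta_regular B (u : bidual (E ord_max)) :
  regular_form B -> regular_form (theta u B).
Proof.
move=> rB; have := rB; move=> [B1 [B2 [p1 p2 BE]]].
(* Bilinear expansion over the positive and negative parts of [u] and over [B1] and [B2], arranged
   to match [regular_formD]. *)
have thE : theta u B = fun y =>
    1 * ((-1) * theta (lpos (- u)) B1 y + theta (lpos u) B1 y) +
    ((-1) * theta (lpos u) B2 y + theta (lpos (- u)) B2 y).
  apply/funext => y.
  rewrite !thetaE.
  have -> : slice B y = slice B1 y - slice B2 y.
    have r1 := positive_regular p1; have r2 := positive_regular p2.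
    by apply: dualP => t; rewrite dual_addE dual_oppE !sliceE// BE.
  have uE f : u f = lpos u f - lpos (- u) f by rewrite {1}(lposB u).
  by rewrite linearB/= !uE; lra.
rewrite thE; apply: regular_formD; apply: regular_formD;
  by apply/positive_regular/theta_positive => //; exact: lpos_ge0.
Qed.

Lemma thetaD B C (a : R) (u : bidual (E ord_max)) :
  regular_form B -> regular_form C ->
  theta u (fun x => a * B x + C x) = fun y => a * theta u B y + theta u C y.
Proof.
move=> rB rC; apply/funext => y; rewrite !thetaE.
have -> : slice (fun x => a * B x + C x) y = a *: slice B y + slice C y.
  apply: dualP => t; rewrite dual_addE dual_scaleE !sliceE//.
  exact: regular_formD.
by rewrite linearD linearZ.
Qed.

End Snoc.

(** * The Aron-Berner extension and its convergence properties *)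

Section AronBernerTheory.
Variable R : realType.

Lemma aron_bernerD m (E : 'I_m -> banachLatticeType R) B C (a : R) x :
  regular_form B -> regular_form C ->
  @aron_berner R m E (fun y => a * B y + C y) x =
  a * aron_berner B x + aron_berner C x.
Proof.
elim: m E B C x => [|m IH] E B C x rB rC //=.
by rewrite thetaD// IH//; exact: theta_regular.
Qed.

Lemma aron_bernerB m (E : 'I_m -> banachLatticeType R) B C x :
  positive_multilinear B -> positive_multilinear C ->
  @aron_berner R m E (B \- C) x = aron_berner B x - aron_berner C x.
Proof.
move=> pB pC; have -> : B \- C = fun y => (-1) * C y + B y.
  by apply/funext => y /=; lra.
by rewrite aron_bernerD; [lra|exact: positive_regular..].
Qed.

Lemma aron_berner_ge0 m (E : 'I_m -> banachLatticeType R) B x :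
  positive_multilinear B -> (forall i, 0 <= x i) ->
  0 <= @aron_berner R m E B x.
Proof.
elim: m E B x => [|m IH] E B x pB x0 /=; first by apply: (pB.2) => -[].
by apply: IH => [|j]; [exact: theta_positive|exact: x0].
Qed.

Lemma aron_berner_multilinear m (E : 'I_m -> banachLatticeType R) B :
  regular_form B -> multilinear (@aron_berner R m E B).
Proof.
elim: m E B => [|m IH] E B rB; first by case.
apply: ord_max_ind => [|j] x a s t /=.
  rewrite !dfwithin.
  have xE r : (fun j : 'I_m => dfwith x ord_max r (lift ord_max j)) =
      fun j => x (lift ord_max j).
    by apply: functional_extensionality_dep => j; rewrite dfwithout// neq_lift.
  rewrite !xE.
  have -> : theta (a *: s + t) B = fun y => a * theta s B y + theta t B y by [].
  by rewrite aron_bernerD//; exact: theta_regular.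
have xE r : (fun k : 'I_m => dfwith x (lift ord_max j) r (lift ord_max k)) =
    dfwith (fun l : 'I_m => x (lift ord_max l)) j r.
  by apply: functional_extensionality_dep => k; rewrite dfwith_lift.
have maxE r : dfwith x (lift ord_max j) r ord_max = x ord_max.
  by rewrite dfwithout// eq_sym neq_lift.
rewrite !xE !maxE.
by apply: IH; exact: theta_regular.
Qed.

Lemma aron_berner_positive m (E : 'I_m -> banachLatticeType R) B :
  positive_multilinear B -> positive_multilinear (@aron_berner R m E B).
Proof.
move=> pB; split; first exact/aron_berner_multilinear/positive_regular.
by move=> x x0; exact: aron_berner_ge0.
Qed.

Lemma evaluation_exists (F : banachLatticeType R) (x : F) :
  exists u : bidual F, forall f, u f = f x.
Proof.
apply: bounded_dual => [f g|a f|]; [by []|by []|].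
by exists `|x| => f; rewrite mulrC ler_dual.
Qed.

Definition evaluation (F : banachLatticeType R) (x : F) : bidual F :=
  sval (cid (evaluation_exists x)).

Lemma evaluationE (F : banachLatticeType R) (x : F) f : evaluation x f = f x.
Proof. exact: (svalP (cid (evaluation_exists x))). Qed.

Lemma evaluation_ge0 (F : banachLatticeType R) (x : F) :
  0 <= x -> 0 <= evaluation x.
Proof.
by move=> x0; apply/le_dualP => f f0; rewrite evaluationE; exact: dual_ge0.
Qed.

Lemma theta_evaluation m (E : 'I_m.+1 -> banachLatticeType R) B t y :
  theta (evaluation t) B y = @slice R m E B y t.
Proof. by rewrite thetaE evaluationE. Qed.

(** Convergence results for the extension descend to the form itself along the canonical
    embeddings. *)
Lemma aron_berner_evaluation m (E : 'I_m -> banachLatticeType R) B x :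
  regular_form B -> @aron_berner R m E B (fun i => evaluation (x i)) = B x.
Proof.
elim: m E B x => [|m IH] E B x rB /=.
  by congr (B _); apply: functional_extensionality_dep => -[].
rewrite IH; last exact: theta_regular.
by rewrite theta_evaluation sliceE// tuple_snoc_eta.
Qed.

(** For [c >= 0] the norm of [f] exceeds [c / C], which some [t] witnesses. Its modulus, rescaled to
    norm [C], does at least as well because [f] is positive. For [c < 0] the vector 0 suffices. *)
Lemma dual_norm_approx (F : banachLatticeType R) (u : bidual F) (f : dual F)
    (C c : R) :
    0 < C -> `|u| <= C -> 0 <= f -> c < u f ->
  exists t : F, [/\ 0 <= t, `|t| <= C & c < f t].
Proof.
move=> C0 uC f0 cf; have [c0|c0] := ltP c 0.
  by exists 0; split; rewrite ?normr0 ?linear0//; exact: ltW.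
have fC : c / C < `|f|.
  rewrite ltr_pdivrMr// (lt_le_trans cf)// (le_trans (ler_norm _))//.
  by rewrite (le_trans (ler_dual _ _))// mulrC ler_wpM2l.
have [t tP] : exists t, c / C * `|t| < `|f t|.
  apply: contrapT => no; move: fC; rewrite ltNge => /negP; apply.
  apply: dual_norm_le => [|t]; first by rewrite divr_ge0// ltW.
  by rewrite leNgt; apply/negP => h; apply: no; exists t.
have t0 : 0 < `|t|.
  by rewrite normr_gt0; apply: contraTneq tP => ->;
    rewrite linear0 !normr0 mulr0 ltxx.
exists ((C / `|t|) *: labs t); split.
- by rewrite lat_scale_ge0 ?labs_ge0// divr_ge0// ltW.
- rewrite normrZ norm_labs ger0_norm; last by rewrite divr_ge0// ltW.
  by rewrite divfK// gt_eqF.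
- rewrite linearZ /GRing.scale/= -ltr_pdivrMl ?divr_gt0// invf_div mulrC mulrA.
  rewrite mulrAC (lt_le_trans tP)// ler_norml; apply/andP; split.
    by rewrite lerNl -linearN; apply: dual_homo => //; exact: leN_labs.
  by apply: dual_homo => //; exact: le_labs.
Qed.

(** Bidual variables are replaced one at a time: the induction hypothesis for [theta (x ord_max) B]
    handles all but the last, and [dual_norm_approx] for [slice B y] the last. *)
Lemma aron_berner_approx m (E : 'I_m -> banachLatticeType R) B
    (x : forall i, bidual (E i)) (C : 'I_m -> R) (c : R) :
    positive_multilinear B -> (forall i, 0 <= x i) -> (forall i, 0 < C i) ->
    (forall i, `|x i| <= C i) -> c < @aron_berner R m E B x ->
  exists y : forall i, E i, [/\ forall i, 0 <= y i, forall i, `|y i| <= C i &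
    c < B y].
Proof.
elim: m E B x C => [|m IH] E B x C pB x0 C0 xC /= cB.
  by eexists; split; last exact: cB; case.
have [||||y [y0 yC cy]] := IH _ _ _ (fun j => C (lift ord_max j)) _ _ _ _ cB.
- exact: theta_positive.
- by move=> j; exact: x0.
- by move=> j; exact: C0.
- by move=> j; exact: xC.
rewrite thetaE in cy.
have [t [t0 tC ct]] := dual_norm_approx (C0 _) (xC _) (slice_ge0 pB y0) cy.
exists (tuple_snoc y t); split.
- exact: tuple_snoc_ge0.
- by apply: ord_max_ind => [|j]; rewrite ?tuple_snoc_max ?tuple_snoc_lift.
- by rewrite -sliceE//; exact: positive_regular.
Qed.

Lemma dual_sumE (F : banachLatticeType R) (f : nat -> dual F) N t :
  (\sum_(n < N) f n) t = \sum_(n < N) f n t.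
Proof.
elim: N => [|N IH]; first by rewrite !big_ord0.
by rewrite !big_ord_recr /= -IH.
Qed.

(** Freezing all but the last variable of [Bn n] gives positive functionals [h n]. For [F >= 0] the
    forms [theta F (Bn n)] are summable below [theta F B], so by induction [h] is weakly null, hence
    norm null by the Schur property; the last variable is bounded. *)
Lemma summable_forms_cvg0 m (E : 'I_m -> banachLatticeType R) B
    (Bn : nat -> (forall i, E i) -> R) (x : nat -> forall i, E i) :
    (forall i, positive_schur (dual (E i))) ->
    positive_multilinear B -> (forall n, positive_multilinear (Bn n)) ->
    (forall N (y : forall i, E i), (forall i, 0 <= y i) ->
      \sum_(n < N) Bn n y <= B y) ->
    (forall n i, 0 <= x n i) -> (forall i, exists C, forall n, `|x n i| <= C) ->
  (fun n => Bn n (x n)) @ \oo --> (0 : R).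
Proof.
elim: m E B Bn x => [|m IH] E B Bn x schur pB pBn Bsum x0 xb.
  (* Without variables there is only one tuple, and the values are the terms of a nonnegative series
     with bounded partial sums. *)
  have xE n : x n = x 0 by apply: functional_extensionality_dep => -[].
  rewrite (_ : (fun n => _) = fun n => Bn n (x 0)); last first.
    by apply/funext => n; rewrite xE.
  apply: cvg_series_cvg_0; apply: nondecreasing_is_cvgn.
    apply/nondecreasing_seqP => n; rewrite /series/= big_nat_recr//= lerDl.
    by apply: (pBn n).2; exact: x0.
  by exists (B (x 0)) => _ [N _ <-]; rewrite /series/= big_mkord; exact: Bsum.
pose y n (j : 'I_m) := x n (lift ord_max j).
have y0 n j : 0 <= y n j by exact: x0.
pose h n := slice (Bn n) (y n).
have h0 n : 0 <= h n by exact: slice_ge0.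
have hcv : h @ \oo --> (0 : dual (E ord_max)).
  apply: (schur ord_max) => //; apply: ge0_weakly_null => F F0.
  apply: (IH _ (theta F B) (fun n => theta F (Bn n)) y) => //.
  - exact: theta_positive.
  - by move=> n; exact: theta_positive.
  - move=> N z z0; rewrite thetaE.
    have -> : \sum_(n < N) theta F (Bn n) z = F (\sum_(n < N) slice (Bn n) z).
      by rewrite linear_sum.
    apply: dual_homo => //; apply/le_dualP => t t0.
    rewrite (dual_sumE (fun n => slice (Bn n) z)) sliceE;
      last exact: positive_regular.
    apply: le_trans (Bsum N _ (tuple_snoc_ge0 z0 t0)).
    apply: ler_sum => n _; rewrite sliceE//; exact: positive_regular.
have [C CP] := xb ord_max.
apply: (@le_cvg0 _ _ (fun n => `|h n| * C)) => [n|].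
  have -> : Bn n (x n) = h n (x n ord_max).
    by rewrite /h sliceE ?tuple_snoc_eta//; exact: positive_regular.
  by rewrite (le_trans (ler_dual _ _))// ler_wpM2l.
rewrite -(mul0r C); apply: cvgM; last exact: cvg_cst.
by rewrite -(normr0 (dual (E ord_max))); exact: cvg_norm.
Qed.

Lemma theta_weak_star_null m (E : 'I_m.+1 -> banachLatticeType R) B
    (u : nat -> bidual (E ord_max)) (y : nat -> forall j, E (lift ord_max j)) :
    (forall i, positive_schur (dual (E i))) -> positive_multilinear B ->
    (forall n, 0 <= u n) -> weak_star_null u ->
    (forall n j, 0 <= y n j) ->
    (forall j, exists C, forall n, `|y n j| <= C) ->
  (fun n => theta (u n) B (y n)) @ \oo --> (0 : R).
Proof.
move=> schur pB u0 uw y0 yb; have rB := positive_regular pB.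
(* Each of the [m] remaining variables needs a factor [2^-1 ^+ n] to be order bounded along a
   sequence; [m]-linearity turns them into the weight. *)
apply: (@weak_star_null_uniform _ _ (fun n => (2^-1 ^+ n) ^+ m)
  (fun n => slice B (y n))) => //.
- by move=> n; rewrite exprn_gt0// exprn_gt0// invr_gt0.
- by move=> n; exact: slice_ge0.
- move=> sigma.
  have sb j : exists s, forall n, 2^-1 ^+ n *: y (sigma n) j <= s.
    by have [C CP] := yb j; apply: (@geometric_upper_bound _ _ _ C).
  pose s j := sval (cid (sb j)).
  have sP n j : 2^-1 ^+ n *: y (sigma n) j <= s j := svalP (cid (sb j)) n.
  exists (slice B s) => n; apply/le_dualP => t t0.
  have pt : positive_multilinear (theta (evaluation t) B).
    by apply: theta_positive => //; exact: evaluation_ge0.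
  rewrite dual_scaleE -!theta_evaluation -(multilinear_scale _ _ pt.1).
  apply: positive_form_le => // j.
  by rewrite lat_scale_ge0// exprn_ge0// invr_ge0.
- move=> sigma g gf gd; apply: (schur ord_max) => [n|]; first by case/andP: (gf n).
  apply: ge0_weakly_null => Phi Phi0.
  have g0 n : 0 <= g n by case/andP: (gf n).
  have [psi [psi0 psig psis]] := disjoint_components Phi0 g0 gd.
  apply: (@le_cvg0 _ _ (fun n => theta (psi n) B (y (sigma n)))) => [n|].
    rewrite ger0_norm ?(dual_ge0 Phi0)// (le_trans (psig n))//.
    by apply: dual_homo => //; case/andP: (gf n).
  apply: (@summable_forms_cvg0 _ _ (theta Phi B) (fun n => theta (psi n) B)).
  + by move=> j; exact: schur.
  + exact: theta_positive.
  + by move=> n; exact: theta_positive.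
  + move=> N z z0; rewrite thetaE.
    have := psis N => /le_dualP/(_ (slice B z) (slice_ge0 pB z0)).
    by rewrite dual_sumE.
  + by [].
  + by move=> j; have [C CP] := yb j; exists C.
Qed.

Lemma aron_berner_weak_star_null m (E : 'I_m.+1 -> banachLatticeType R) B
    (x : forall i, nat -> bidual (E i)) :
    (forall i, positive_schur (dual (E i))) -> positive_multilinear B ->
    (forall i n, 0 <= x i n) -> weak_star_null (x ord_max) ->
    (forall k, k != ord_max -> exists2 C, 0 < C & forall n, `|x k n| <= C) ->
  (fun n => aron_berner B (fun i => x i n)) @ \oo --> (0 : R).
Proof.
move=> schur pB x0 xw xb.
have /choice[C CP] (j : 'I_m) : exists C : R,
    0 < C /\ forall n, `|x (lift ord_max j) n| <= C.
  by have [|C C0 CP] := xb (lift ord_max j); [rewrite eq_sym neq_lift|exists C].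
(* All bidual variables but the last are traded for vectors of the original lattices, at the cost of
   an error [1 / (n + 1)] that tends to 0. *)
have yex n : exists y : forall j : 'I_m, E (lift ord_max j),
    [/\ forall j, 0 <= y j, forall j, `|y j| <= C j &
    aron_berner B (fun i => x i n) - n.+1%:R^-1 < theta (x ord_max n) B y].
  apply: (@aron_berner_approx _ _ _ (fun j => x (lift ord_max j) n)).
  - exact: theta_positive.
  - by move=> j; exact: x0.
  - by move=> j; case: (CP j).
  - by move=> j; case: (CP j).
  - by rewrite /= ltrBlDr ltrDl invr_gt0.
pose y n := sval (cid (yex n)).
have yP n : [/\ forall j, 0 <= y n j, forall j, `|y n j| <= C j &
    aron_berner B (fun i => x i n) - n.+1%:R^-1 < theta (x ord_max n) B (y n)].
  exact: svalP (cid (yex n)).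
apply: (@le_cvg0 _ _ (fun n => theta (x ord_max n) B (y n) + n.+1%:R^-1)).
  move=> n; rewrite ger0_norm; last by apply: aron_berner_ge0.
  by rewrite -lerBlDr ltW//; case: (yP n).
rewrite -[0](addr0 0); apply: cvgD; last exact: cvg_harmonic.
apply: theta_weak_star_null => //.
- by move=> n j; case: (yP n).
- by move=> j; exists (C j) => n; case: (yP n).
Qed.

End AronBernerTheory.

Theorem theorem3p9 (R : realType) (m : nat)
    (E : 'I_m.+1 -> banachLatticeType R) (A : (forall i, E i) -> R) :
  (forall i, positive_schur (dual (E i))) ->
  regular_form A ->
  [/\ forall x : forall i, nat -> bidual (E i),
        positive_seq (x ord_max) -> weak_star_null (x ord_max) ->
        (forall k, k != ord_max -> bounded_fun (x k)) ->
        (fun n => aron_berner A (fun i => x i n)) @ \oo --> (0 : R),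
      almost_dunford_pettis A &
      almost_dunford_pettis (aron_berner A)].
Proof.
move=> schur rA; have := rA; move=> [B [C [pB pC AE]]].
(* Extensions of positive forms are positive, so their values are dominated by those at the moduli.
   This serves the first and the last claim. *)
have reduce (x : forall i, nat -> bidual (E i)) :
    weak_star_null (fun n => labs (x ord_max n)) ->
    (forall k, k != ord_max -> exists2 M, 0 < M & forall n, `|x k n| <= M) ->
    (fun n => aron_berner A (fun i => x i n)) @ \oo --> (0 : R).
  move=> xw xb.
  have cv D : positive_multilinear D ->
      (fun n => aron_berner D (fun i => x i n)) @ \oo --> (0 : R).
    move=> pD.
    apply: (@le_cvg0 _ _ (fun n => aron_berner D (fun i => labs (x i n)))).
      move=> n; apply: (@norm_positive_form _ _ _ (aron_berner D)).
      exact: aron_berner_positive.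
    apply: (@aron_berner_weak_star_null _ _ _ _ (fun i n => labs (x i n))) => //.
      by move=> i n; exact: labs_ge0.
    by move=> k /xb[M M0 MP]; exists M => // n; rewrite norm_labs.
  rewrite (_ : (fun n => _) = fun n => aron_berner B (fun i => x i n) -
      aron_berner C (fun i => x i n)); last first.
    by apply/funext => n; rewrite AE aron_bernerB.
  by rewrite -[0](subr0 0); apply: cvgB; exact: cv.
have weak_star (F : banachLatticeType R) (u : nat -> bidual F) :
    weakly_null u -> weak_star_null u.
  move=> uw f; have := uw (evaluation f).
  by under eq_fun do rewrite evaluationE.
split.
- move=> x x0 xw xb; apply: reduce => [|k /xb].
    rewrite (_ : (fun n => _) = x ord_max)//.
    by apply/funext => n; rewrite ge0_labs.
  move=> /pinfty_ex_gt0[M M0 MP]; exists M => // n; exact: MP.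
- split=> [|x xd]; first exact: regular_multilinear.
  (* Disjointness makes the moduli weakly null, which for their images in the bidual is weak-star
     nullity. *)
  have xw i : weak_star_null (fun n => evaluation (labs (x i n))).
    have [d w] := xd i; move=> f; under eq_fun do rewrite evaluationE.
    exact: (disjoint_labs_weakly_null d w).
  have e0 i n : 0 <= evaluation (labs (x i n)).
    exact/evaluation_ge0/labs_ge0.
  have cv D : positive_multilinear D ->
      (fun n => D (fun i => x i n)) @ \oo --> (0 : R).
    move=> pD.
    apply: (@le_cvg0 _ _ (fun n =>
      aron_berner D (fun i => evaluation (labs (x i n))))).
      move=> n; rewrite aron_berner_evaluation; last exact: positive_regular.
      exact: norm_positive_form.
    apply: (@aron_berner_weak_star_null _ _ _ _
      (fun i n => evaluation (labs (x i n)))) => //.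
    (* The bounds on the other variables come from uniform boundedness, as every one of these
       sequences is positive and weak-star null. *)
    by move=> k _; apply: weak_star_null_bounded.
  rewrite AE -[0](subr0 0); apply: cvgB; exact: cv.
- split=> [|x xd]; first exact: aron_berner_multilinear.
  have xw i : weak_star_null (fun n => labs (x i n)).
    by have [d w] := xd i; apply: weak_star; exact: disjoint_labs_weakly_null.
  apply: reduce => // k _.
  have [n|M M0 MP] := weak_star_null_bounded _ (xw k); first exact: labs_ge0.
  by exists M => // n; rewrite -norm_labs.
Qed.
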